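(* Let $\mathcal{D}=(G,\chi,z,\lambda,q)$, $n$, $p=\chi(z)$ and $H_{\mathcal{D}}$ be as in the context, with $(p,q)\neq(1,-1)$. Let $(B,s)$ be a right $H_{\mathcal{D}}$-comodule algebra, with associated subspaces $B_{g,\zeta}$ and maps $\alpha,U$, let $C:=B^{\mathrm{coH}_{\mathcal{D}}}$, and assume that $(C\hookrightarrow B,s)$ is cleft. Take $b_x\in B$ and a family $(b_g)_{g\in G}$ of elements of $B^\times$ with $b_1=1_B$ such that (a) $b_g\in B_{g,\mathrm{id}}\cap\ker(U)$ for all $g\in G$, (b) $b_x\in B_{z,\mathrm{id}}\cap U^{-1}(1_B)$, (c) $\alpha(b_x)=q\,b_x$, (d) $\alpha(b_g)=b_g$ for all $g\in G$. Let $\gamma\colon H_{\mathcal D}\to B$ be the cleft map $\gamma(gx^i)=b_gb_x^i$. Then: (1) $B$ is a free left $C$-module with basis $\{b_gb_x^i:g\in G\text{ and }0\le i<n\}$. (2) Set $\mathfrak{b}:=b_x^nb_z^{|z|-n}$ and, for all $g\in G$, set $\mathfrak{a}_g:=b_g^{|g|}$ and $\mathfrak{c}_g:=(b_xb_g-\chi(g)b_gb_x)b_g^{-1}b_z^{-1}$. Then $\mathfrak{a}_g\in C^\times$, $\mathfrak{c}_g\in C$, and if $x^n=0$, then $\mathfrak{b}\in C$. (3) The weak action of $H_{\mathcal{D}}$ on $C$ associated with $\gamma$ is given by $$gx^i\rightharpoonup c=\sum_{j=0}^i(-1)^j(qp)^{\frac{j(j-1)}{2}}\binom{i}{j}_{qp}b_gb_x^{i-j}\alpha^j(c)b_x^jb_{\zeta(g)z^i}^{-1}\quad\text{for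 } c\in B_{1_G,\zeta}\cap\ker(U).$$ (4) The two-cocycle $\sigma\colon H_{\mathcal{D}}\otimes H_{\mathcal{D}}\to C$ associated with $\gamma$ is given, for $g,h\in G$ and $0\le s,r<n$, by $$\begin{aligned} \sigma(gx^s\otimes hx^r)&=\sum_{\substack{0\le i\le s\\0\le j\le r\\ \xi_{ij}<n}}(-1)^{\xi_{ij}}\binom{s}{i}_{qp}\binom{r}{j}_{qp}(qp)^{\frac{\xi_{ij}(\xi_{ij}-1)}{2}+sj-ij}\chi(h)^{s-i}b_gb_x^ib_hb_x^{s+r-i}b_{ghz^{s+r}}^{-1}\\ &+\lambda\sum_{\substack{0\le i\le s\\0\le j\le r\\ \xi_{ij}\ge n}}(-1)^{\xi'_{ij}}\binom{s}{i}_{qp}\binom{r}{j}_{qp}(qp)^{\frac{\xi'_{ij}(\xi'_{ij}-1)}{2}+sj-ij}\chi(h)^{s-i}b_gb_x^ib_hb_x^{\xi_{in}}b_{ghz^{s+r}}^{-1}\\ &-\lambda\sum_{\substack{0\le i\le s\\0\le j\le r\\ \xi_{ij}\ge n}}(-1)^{\xi'_{ij}}\binom{s}{i}_{qp}\binom{r}{j}_{qp}(qp)^{\frac{\xi'_{ij}(\xi'_{ij}-1)}{2}+sj-ij}\chi(h)^{s-i}b_gb_x^ib_hb_x^{\xi_{in}}b_{ghz^{s+r-n}}^{-1}, \end{aligned}$$ where $\xi_{ij}:=s+r-i-j$ (so $\xi_{in}=s+r-i-n$) and $\xi'_{ij}:=\xi_{ij}-n$.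
   Context: $k$ is a field, all maps are $k$-linear, $\otimes=\otimes_k$, algebras are associative unital, and the name of a space also denotes its identity map. $(j)_t=\sum_{i=0}^{j-1}t^i$, $(j)!_t=(1)_t\cdots(j)_t$, and $\binom{i}{j}_t=\frac{(i)!_t}{(j)!_t(i-j)!_t}$ ($0\le j\le i$) is the Gaussian binomial, a polynomial in $t$ that may be evaluated at any element of $k$. $|g|$ denotes the order of $g\in G$; $B^\times$, $C^\times$ are groups of units. Data: $G$ is a finite group, $\chi\colon G\to k^\times$ a character, $z\in G$ central, $q\in k^\times$, $\lambda\in k$, $p:=\chi(z)$; $qp$ is a root of $1$ of order $n>1$; and $\chi^n=1$ if $\lambda(z^n-1_G)\ne0$. $H_{\mathcal D}$ is the braided Hopf algebra generated as an algebra by the group $G$ and an element $x$ with relations $x^n=\lambda(z^n-1_G)$, $xg=\chi(g)gx$ ($g\in G$); it has basis $\{gx^i:g\in G,0\le i<n\}$, comultiplication and counit determined by $\Delta(g)=g\otimes g$, $\Delta(x)=1\otimes x+x\otimes z$, $\epsilon(g)=1$, $\epsilon(x)=0$, and braid $c=c_q$, $c_q(gx^i\otimes hx^j)=q^{ij}hx^j\otimes gx^i$. (As in any braided bialgebra, $\Delta\mu=(\mu\otimes\mu)(H\otimes c\otimes H)(\Delta\otimes\Delta)$.) $\mathrm{Aut}_{\chi,z}(G)$ is the group of automorphisms $\phi$ of $G$ with $\phi(z)=z$ and $\chi\circ\phi=\chi$. For a braided bialgebra $H$ with braid $c$, a left transposition of $H$ on an algebra $B$ is a bijective map $s\colon H\otimes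 B\to B\otimes H$ such that: $s(1_H\otimes b)=b\otimes1_H$; $s\circ(\mu_H\otimes B)=(B\otimes\mu_H)\circ(s\otimes H)\circ(H\otimes s)$; $(B\otimes\epsilon)\circ s=\epsilon\otimes B$; $(B\otimes\Delta)\circ s=(s\otimes H)\circ(H\otimes s)\circ(\Delta\otimes B)$; $(s\otimes H)\circ(H\otimes s)\circ(c\otimes B)=(B\otimes c)\circ(s\otimes H)\circ(H\otimes s)$; $s(h\otimes1_B)=1_B\otimes h$; $s\circ(H\otimes\mu_B)=(\mu_B\otimes H)\circ(B\otimes s)\circ(s\otimes B)$. A right $H$-comodule algebra $(B,s)$ is an algebra $B$ with an ordinary right $H$-comodule structure $\nu\colon B\to B\otimes H$ and a left transposition $s$ of $H$ on $B$ such that $(\nu\otimes H)\circ s=(B\otimes c)\circ(s\otimes H)\circ(H\otimes\nu)$, $\nu\circ\mu_B=(\mu_B\otimes\mu_H)\circ(B\otimes s\otimes H)\circ(\nu\otimes\nu)$ and $\nu(1_B)=1_B\otimes1_H$. Put $B^{\mathrm{coH}}=\{b\in B:\nu(b)=b\otimes1_H\}$ (a subalgebra). Associated objects: for a right $H_{\mathcal D}$-comodule algebra $(B,s)$, there are (under the standing assumption $(p,q)\ne(1,-1)$) a unique vector space decomposition $B=\bigoplus_{(g,\zeta)\in G\times\mathrm{Aut}_{\chi,z}(G)}B_{g,\zeta}$, a unique algebra automorphism $\alpha$ of $B$ and a unique linear map $U\colon B\to B$ with $\alpha(B_{g,\zeta})=B_{g,\zeta}$, $U(B_{g,\zeta})\subseteq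 B_{z^{-1}g,\zeta}$, $U^n=0$, $U\circ\alpha=q\,\alpha\circ U$, such that $s(gx^i\otimes b)=\alpha^i(b)\otimes\zeta(g)x^i$ for $b\in\bigoplus_hB_{h,\zeta}$ and $\nu(b)=\sum_{i=0}^{n-1}\frac1{(i)!_{qp}}U^i(b)\otimes z^{-i}gx^i$ for $b\in B_g:=\bigoplus_\zeta B_{g,\zeta}$. One has $C=\bigoplus_{\zeta}B_{1_G,\zeta}\cap\ker(U)$. The extension $(C\hookrightarrow B,s)$ is cleft if there is a cleft map, i.e. a right $H_{\mathcal D}$-colinear map $\gamma\colon H_{\mathcal D}\to B$ invertible for the convolution product $f*g=\mu_B\circ(f\otimes g)\circ\Delta$ and satisfying $(\gamma\otimes H_{\mathcal D})\circ c_q=s\circ(H_{\mathcal D}\otimes\gamma)$. The map $\gamma(gx^i)=b_gb_x^i$ above is a cleft map, with $\gamma(1)=1_B$. With $i\colon C\hookrightarrow B$ the inclusion, $s_C\colon H_{\mathcal D}\otimes C\to C\otimes H_{\mathcal D}$ the restriction of $s$ and $\gamma^{-1}$ the convolution inverse of $\gamma$, the weak action $\rho\colon H_{\mathcal D}\otimes C\to C$, $\rho(h\otimes c)=h\rightharpoonup c$, and the two-cocycle $\sigma$ associated with $\gamma$ are the maps given by $i\circ\rho=\mu_B\circ(\mu_B\otimes B)\circ(\gamma\otimes i\otimes\gamma^{-1})\circ(H_{\mathcal D}\otimes s_C)\circ(\Delta\otimes C)$ and $i\circ\sigma=\mu_B\circ(\mu_B\otimes\gamma^{-1})\circ(\gamma\otimes\gamma\otimes\mu_{H_{\mathcal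 D}})\circ(H_{\mathcal D}\otimes c_q\otimes H_{\mathcal D})\circ(\Delta\otimes\Delta)$ (both take values in $C$). *)

(* Defs.v *)
From HB Require Import structures.
From mathcomp Require Import all_boot all_order all_fingroup all_algebra.
From mathcomp Require Import zify.
From Stdlib Require Import ClassicalEpsilon.

Set Implicit Arguments.
Unset Strict Implicit.
Unset Printing Implicit Defensive.

Import GRing.Theory.
Local Open Scope ring_scope.

Section QNumbers.
Variable k : fieldType.
Implicit Types (i j : nat) (t : k).

Definition qnum_poly j : {poly k} := \sum_(i < j) 'X^i.
Definition qfact_poly j : {poly k} := \prod_(1 <= i < j.+1) qnum_poly i.

(* The division is exact, so it may be carried out before evaluation. *)
Definition qbinom_poly i j : {poly k} :=
  qfact_poly i %/ (qfact_poly j * qfact_poly (i - j)).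

Definition qfact t j : k := (qfact_poly j).[t].
Definition qbinom t i j : k := (qbinom_poly i j).[t].

End QNumbers.

(* [lam *: (z ^+ n - 1)] is nonzero in k[G] iff [lam != 0] and [z ^+ n != 1]. *)
Record datum (k : fieldType) := Datum {
  dG : finGroupType;
  chi : dG -> k;
  dz : dG;
  lam : k;
  dq : k;
  dn : nat;
  chi1 : chi 1%g = 1;
  chiM : forall g h, chi (g * h)%g = chi g * chi h;
  dz_central : forall g, commute dz g;
  dq_neq0 : dq != 0;
  dn_gt1 : (1 < dn)%N;
  qp_prim : dn.-primitive_root (dq * chi dz);
  chiXn : lam != 0 -> (dz ^+ dn)%g != 1%g -> forall g, chi g ^+ dn = 1
}.

Definition dp k (D : datum k) : k := chi (dz D).
Definition dqp k (D : datum k) : k := dq D * dp D.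

(* [(g, i)] indexes the basis element g x^i of H_D. *)
Notation hidx D := (dG D * 'I_(dn D))%type.

(* H_D is realized on coordinate vectors in the basis (g x^i); the relations
   defining it are hGM, hXG and hXn below. *)
Definition HD k (D : datum k) : Type := {ffun hidx D -> k^o}.

HB.instance Definition _ k (D : datum k) := GRing.Lmodule.on (HD D).

Section HopfAlgebra.
Variables (k : fieldType) (D : datum k).
Local Notation n := (dn D).
Local Notation z := (dz D).
Implicit Types (g h l : dG D) (i j m : nat) (a b c : hidx D) (u v w : HD D).

(* The basis vector g x^m; it is 0 if n <= m. *)
Definition hvec g m : HD D := [ffun a : hidx D => ((a.1 == g) && (a.2 == m :> nat))%:R].

(* The normal form of g x^m for m < 2n, obtained from x^n = lam (z^n - 1). *)
Definition hred g m : HD D :=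
  if (m < n)%N then hvec g m
  else lam D *: (hvec (g * z ^+ n)%g (m - n) - hvec g (m - n)).

(* (g x^i) (h x^j) = chi(h)^i gh x^(i+j), since x h = chi(h) h x. *)
Definition hmul_basis g i h j : HD D := chi h ^+ i *: hred (g * h)%g (i + j).

Definition hmul u v : HD D :=
  \sum_a \sum_b (u a * v b) *: hmul_basis a.1 a.2 b.1 b.2.

Definition hone : HD D := hvec 1%g 0.

Lemma hvec_idx a b : hvec a.1 a.2 b = (b == a)%:R.
Proof. by rewrite ffunE; case: a b => [g i] [h j]; rewrite /= xpair_eqE. Qed.

Lemma hvec_sum u : u = \sum_a u a *: hvec a.1 a.2.
Proof.
apply/ffunP=> b; rewrite sum_ffunE (bigD1 b) //= !ffunE !eqxx /=.
rewrite big1 => [|a ab]; first by rewrite addr0 [RHS]mulr1.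
rewrite ffunE hvec_idx eq_sym (negPf ab).
exact: mulr0.
Qed.

Lemma hmulDl : left_distributive hmul +%R.
Proof.
move=> u v w; rewrite /hmul -big_split; apply: eq_bigr => a _ /=.
rewrite -big_split; apply: eq_bigr => b _ /=.
by rewrite ffunE mulrDl scalerDl.
Qed.

Lemma hmulDr : right_distributive hmul +%R.
Proof.
move=> u v w; rewrite /hmul -big_split; apply: eq_bigr => a _ /=.
rewrite -big_split; apply: eq_bigr => b _ /=.
by rewrite ffunE mulrDr scalerDl.
Qed.

Lemma hmulZl (e : k) u v : hmul (e *: u) v = e *: hmul u v.
Proof.
rewrite /hmul scaler_sumr; apply: eq_bigr => a _.
rewrite scaler_sumr; apply: eq_bigr => b _.
by rewrite ffunE [RHS]scalerA; congr (_ *: _); rewrite [RHS]mulrA.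
Qed.

Lemma hmulZr (e : k) u v : hmul u (e *: v) = e *: hmul u v.
Proof.
rewrite /hmul scaler_sumr; apply: eq_bigr => a _.
rewrite scaler_sumr; apply: eq_bigr => b _.
by rewrite ffunE [RHS]scalerA; congr (_ *: _); apply: mulrCA.
Qed.

Lemma hmul0l v : hmul 0 v = 0.
Proof. by have := hmulZl 0 0 v; rewrite !scale0r. Qed.

Lemma hmul0r u : hmul u 0 = 0.
Proof. by have := hmulZr 0 u 0; rewrite !scale0r. Qed.

Lemma hmulBl u v w : hmul (u - v) w = hmul u w - hmul v w.
Proof. by rewrite -scaleN1r hmulDl hmulZl scaleN1r. Qed.

Lemma hmulBr u v w : hmul u (v - w) = hmul u v - hmul u w.
Proof. by rewrite -scaleN1r hmulDr hmulZr scaleN1r. Qed.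

Lemma hmul_suml (I : finType) (F : I -> HD D) v :
  hmul (\sum_t F t) v = \sum_t hmul (F t) v.
Proof. by apply: (big_morph (hmul^~ v)) => [x y|]; rewrite ?hmulDl ?hmul0l. Qed.

Lemma hmul_sumr (I : finType) u (F : I -> HD D) :
  hmul u (\sum_t F t) = \sum_t hmul u (F t).
Proof. by apply: (big_morph (hmul u)) => [x y|]; rewrite ?hmulDr ?hmul0r. Qed.

Lemma hmul_idx a b : hmul (hvec a.1 a.2) (hvec b.1 b.2) = hmul_basis a.1 a.2 b.1 b.2.
Proof.
rewrite /hmul (bigD1 a) //= (bigD1 b) //= !hvec_idx !eqxx mulr1 scale1r.
rewrite [X in _ + X + _]big1 => [|c cb]; last first.
  by rewrite !hvec_idx (negPf cb) mulr0 scale0r.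
rewrite [X in _ + X]big1 => [|c ca]; first by rewrite !addr0.
by apply: big1 => d _; rewrite !hvec_idx (negPf ca) mul0r scale0r.
Qed.

Lemma hmul_vec g i h j : (i < n)%N -> (j < n)%N ->
  hmul (hvec g i) (hvec h j) = chi h ^+ i *: hred (g * h)%g (i + j).
Proof.
by move=> ltin ltjn; rewrite (hmul_idx (g, Ordinal ltin) (h, Ordinal ltjn)).
Qed.

Lemma zXn_central g : (g * z ^+ n = z ^+ n * g)%g.
Proof. exact/commuteX/commute_sym/dz_central. Qed.



Lemma chiX g i : chi (g ^+ i)%g = chi g ^+ i.
Proof. by elim: i => [|i IHi]; rewrite ?chi1 // expgS chiM IHi exprS. Qed.

Lemma hred_hi g m : (n <= m)%N ->
  hred g m = lam D *: (hvec (g * z ^+ n)%g (m - n) - hvec g (m - n)).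
Proof. by rewrite /hred ltnNge => ->. Qed.

Lemma hred_lo g m : (m < n)%N -> hred g m = hvec g m.
Proof. by rewrite /hred => ->. Qed.

(* chi^n = 1 makes chi(l)^n and chi(z^n) act trivially on lam (z^n - 1). *)
Lemma lam_chi_zn (e : nat) (F : dG D -> HD D) g :
  lam D *: (chi (z ^+ n)%g ^+ e *: F (g * z ^+ n)%g - F g) =
  lam D *: (F (g * z ^+ n)%g - F g).
Proof.
have [->|lam0] := eqVneq (lam D) 0; first by rewrite !scale0r.
have [->|zn1] := eqVneq (z ^+ n)%g 1%g; first by rewrite chi1 expr1n scale1r.
by rewrite chiX (chiXn lam0 zn1) expr1n scale1r.
Qed.

Lemma lam_chiXn l (F : dG D -> HD D) g :
  chi l ^+ n *: (lam D *: (F (g * z ^+ n)%g - F g)) =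
  lam D *: (F (g * z ^+ n)%g - F g).
Proof.
have [->|lam0] := eqVneq (lam D) 0; first by rewrite !scale0r scaler0.
have [->|zn1] := eqVneq (z ^+ n)%g 1%g; first by rewrite mulg1 subrr !scaler0.
by rewrite (chiXn lam0 zn1) scale1r.
Qed.

Lemma hmul_vecA g h l i j m : (i < n)%N -> (j < n)%N -> (m < n)%N ->
  hmul (hvec g i) (hmul (hvec h j) (hvec l m)) =
  hmul (hmul (hvec g i) (hvec h j)) (hvec l m).
Proof.
move=> ltin ltjn ltmn; rewrite !hmul_vec // hmulZl hmulZr.
have lt2 x y : (x < n)%N -> (y < n)%N -> (n <= x + y)%N -> (x + y - n < n)%N.
  by lia.
have -> : hmul (hvec g i) (hred (h * l)%g (j + m)) =
    chi (h * l)%g ^+ i *: (if (j + m < n)%N then hred (g * h * l)%g (i + j + m)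
    else lam D *: (hred (g * h * l * z ^+ n)%g (i + j + m - n)
                   - hred (g * h * l)%g (i + j + m - n))).
  case: ltnP => [lejm|lejm].
    by rewrite hred_lo // hmul_vec // mulgA addnA.
  rewrite hred_hi // hmulZr hmulBr !hmul_vec ?lt2 // !mulgA.
  rewrite addnBA // addnA (chiM (h * l)%g) exprMn -scalerA -scalerBr.
  rewrite [LHS]scalerA (mulrC (lam D)) -[LHS]scalerA.
  by rewrite (lam_chi_zn i (fun x => hred x (i + j + m - n))).
have -> : hmul (hred (g * h)%g (i + j)) (hvec l m) =
    chi l ^+ (i + j) *: (if (i + j < n)%N then hred (g * h * l)%g (i + j + m)
    else lam D *: (hred (g * h * l * z ^+ n)%g (i + j + m - n)
                   - hred (g * h * l)%g (i + j + m - n))).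
  case: ltnP => [leij|leij].
    by rewrite hred_lo // hmul_vec.
  rewrite hred_hi // hmulZl hmulBl !hmul_vec ?lt2 //.
  rewrite addnBAC // -(mulgA (g * h)%g (z ^+ n)%g l) -zXn_central mulgA -scalerBr.
  rewrite -[in chi l ^+ (i + j)](subnK leij) exprD -[RHS]scalerA.
  rewrite (lam_chiXn l (fun x => hred x (i + j + m - n))).
  by rewrite [LHS]scalerA (mulrC (lam D)) -[LHS]scalerA.
set X := hred (g * h * l)%g (i + j + m).
set Y := lam D *: _.
have XY : (n <= i + j + m)%N -> (i + j + m - n < n)%N -> X = Y.
  by move=> le1 lt1; rewrite /X /Y hred_hi // !hred_lo.
have -> : (if (j + m < n)%N then X else Y) = (if (i + j < n)%N then X else Y).
  case: ltnP => lejm; case: ltnP => leij //; [|apply/esym]; apply: XY; lia.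
rewrite !scalerA; congr (_ *: _).
by rewrite chiM exprMn exprD mulrCA [chi l ^+ i * _]mulrC.
Qed.

Lemma hmul_expl u v : hmul u v = \sum_a u a *: hmul (hvec a.1 a.2) v.
Proof.
rewrite {1}(hvec_sum u) [LHS]hmul_suml; apply: eq_bigr => a _.
exact: hmulZl.
Qed.

Lemma hmul_expr u v : hmul u v = \sum_a v a *: hmul u (hvec a.1 a.2).
Proof.
rewrite {1}(hvec_sum v) [LHS]hmul_sumr; apply: eq_bigr => a _.
exact: hmulZr.
Qed.

Lemma hmulA : associative hmul.
Proof.
move=> u v w.
rewrite (hmul_expl u) (hmul_expl u v) [RHS]hmul_suml; apply: eq_bigr => a _.
rewrite [RHS]hmulZl; congr (_ *: _).
rewrite (hmul_expl v) (hmul_expr _ v) [RHS]hmul_suml [LHS]hmul_sumr.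
apply: eq_bigr => b _; rewrite [LHS]hmulZr [RHS]hmulZl; congr (_ *: _).
rewrite (hmul_expr _ w) [RHS](hmul_expr _ w) [LHS]hmul_sumr.
apply: eq_bigr => c _; rewrite [LHS]hmulZr; congr (_ *: _).
exact: hmul_vecA.
Qed.

Lemma hmul1l : left_id hone hmul.
Proof.
move=> u; rewrite [LHS]hmul_expr [RHS]hvec_sum; apply: eq_bigr => a _.
rewrite hmul_vec ?(ltnW (dn_gt1 D)) // expr0 scale1r mul1g add0n.
by rewrite hred_lo.
Qed.

Lemma hmul1r : right_id hone hmul.
Proof.
move=> u; rewrite [LHS]hmul_expl [RHS]hvec_sum; apply: eq_bigr => a _.
rewrite hmul_vec ?(ltnW (dn_gt1 D)) // chi1 expr1n scale1r mulg1 addn0.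
by rewrite hred_lo.
Qed.

Lemma hone_neq0 : hone != 0.
Proof.
apply/eqP => /ffunP/(_ (1%g, Ordinal (ltnW (dn_gt1 D)))) /eqP.
by rewrite !ffunE /= !eqxx oner_eq0.
Qed.

HB.instance Definition _ := GRing.Zmodule_isNzRing.Build (HD D)
  hmulA hmul1l hmul1r hmulDl hmulDr hone_neq0.

Lemma hscalerAl (e : k) (u v : HD D) : e *: (u * v) = (e *: u) * v.
Proof. by rewrite [RHS]hmulZl. Qed.

HB.instance Definition _ := GRing.Lmodule_isLalgebra.Build k (HD D) hscalerAl.

Lemma hscalerAr (e : k) (u v : HD D) : e *: (u * v) = u * (e *: v).
Proof. by rewrite [RHS]hmulZr. Qed.

HB.instance Definition _ := GRing.Lalgebra_isAlgebra.Build k (HD D) hscalerAr.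

Definition hG g : HD D := hvec g 0.
Definition hX : HD D := hvec 1%g 1.

Let n_gt0 : (0 < n)%N. Proof. exact: ltnW (dn_gt1 D). Qed.

Lemma hG1 : hG 1%g = 1. Proof. by []. Qed.

Lemma hGM g h : hG (g * h)%g = hG g * hG h.
Proof. by rewrite [RHS]hmul_vec // expr0 scale1r hred_lo. Qed.

Lemma hXG g : hX * hG g = chi g *: (hG g * hX).
Proof.
rewrite [in LHS]/GRing.mul [in RHS]/GRing.mul /= !hmul_vec ?dn_gt1 //.
by rewrite expr0 expr1 scale1r mul1g mulg1.
Qed.

Lemma hvecE g i : (i < n)%N -> hvec g i = hG g * hX ^+ i.
Proof.
elim: i g => [|i IHi] g ltin; first by rewrite expr0 mulr1.
rewrite exprSr mulrA -IHi 1?ltnW // [RHS]hmul_vec ?dn_gt1 1?ltnW //.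
by rewrite chi1 expr1n scale1r mulg1 addn1 hred_lo.
Qed.

Lemma hXn : hX ^+ n = lam D *: (hG (z ^+ n)%g - 1).
Proof.
have := dn_gt1 D; case En : n => [|m] // _.
rewrite exprSr -[hX ^+ m]mul1r -hG1 -hvecE ?En //.
rewrite [LHS]hmul_vec ?dn_gt1 ?En // chi1 expr1n scale1r mulg1 addn1.
by rewrite hred_hi ?En // subnn mul1g.
Qed.

End HopfAlgebra.

(* For a k-space V, both V (x) H_D and H_D (x) V are V^(hidx D), the vector at
   the index a being the coefficient of the basis element a.  Likewise any
   tensor product with two factors H_D and one factor V, in any position, is
   V^(hidx D * hidx D), the two indices being those of the two factors H_D read
   from left to right; for V = k this is H_D (x) H_D. *)
Notation tH D V := {ffun hidx D -> V}.
Notation tHH D V := {ffun hidx D * hidx D -> V}.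

Section Coalgebra.
Variables (k : fieldType) (D : datum k).
Implicit Types (V W : lmodType k) (a b : hidx D) (u v : HD D).

Definition hbas a : HD D := hvec a.1 a.2.

(* h (x) x and x (x) h *)
Definition tens V u (x : V) : tH D V := [ffun a => u a *: x].

Definition htens u v : tHH D k^o := [ffun ab => u ab.1 * v ab.2].

(* For f sending the basis element i of the finite free space k^I to
   F i in k^J, the map V (x) f : V^I -> V^J. *)
Definition extV (I J : finType) (F : I -> {ffun J -> k^o}) V
    (t : {ffun I -> V}) : {ffun J -> V} :=
  [ffun j => \sum_i F i j *: t i].

(* c_q (x) V and V (x) c_q, where c_q (gx^i (x) hx^j) = q^(ij) hx^j (x) gx^i *)
Definition braidF (ab : hidx D * hidx D) : tHH D k^o :=
  dq D ^+ (ab.1.2 * ab.2.2) *: htens (hbas ab.2) (hbas ab.1).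
Definition braid V : tHH D V -> tHH D V := @extV _ _ braidF V.

(* mu (x) V and V (x) mu *)
Definition mulF (ab : hidx D * hidx D) : tH D k^o := hbas ab.1 * hbas ab.2.
Definition tmul V : tHH D V -> tH D V := @extV _ _ mulF V.

(* (mu (x) mu) o (H (x) c_q (x) H), the product of H_D (x) H_D *)
Definition bmul (t t' : tHH D k^o) : tHH D k^o :=
  \sum_ab \sum_ab' (t ab * t' ab') *:
    \sum_cd braidF (ab.2, ab'.1) cd *:
      htens (hbas ab.1 * hbas cd.1) (hbas cd.2 * hbas ab'.2).

(* Delta is multiplicative for bmul, with Delta g = g (x) g and
   Delta x = 1 (x) x + x (x) z. *)
Definition DeltaX : tHH D k^o := htens 1 (hX D) + htens (hX D) (hG (dz D)).
Definition DeltaF a : tHH D k^o :=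
  iter a.2 (bmul^~ DeltaX) (htens (hG a.1) (hG a.1)).
Definition Delta u : tHH D k^o := \sum_a u a *: DeltaF a.
(* Delta (x) V and V (x) Delta *)
Definition tDelta V : tH D V -> tHH D V := @extV _ _ DeltaF V.

Definition eps u : k := \sum_a u a * (a.2 == 0 :> nat)%:R.
(* eps (x) V and V (x) eps *)
Definition teps V (t : tH D V) : V := \sum_a eps (hbas a) *: t a.

(* f acting on the tensor factor V and the left, resp. right, factor H_D *)
Definition actl V W (f : tH D V -> tH D W) (t : tHH D V) : tHH D W :=
  [ffun ab => f [ffun a => t (a, ab.2)] ab.1].
Definition actr V W (f : tH D V -> tH D W) (t : tHH D V) : tHH D W :=
  [ffun ab => f [ffun b => t (ab.1, b)] ab.2].

(* for f : H_D -> V, the maps f (x) H_D and H_D (x) f *)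
Definition mapl V (f : HD D -> V) (t : tHH D k^o) : tH D V :=
  [ffun b => \sum_a t (a, b) *: f (hbas a)].
Definition mapr V (f : HD D -> V) (t : tHH D k^o) : tH D V :=
  [ffun a => \sum_b t (a, b) *: f (hbas b)].

(* for f : V -> V (x) H_D, the maps f (x) H_D : V (x) H_D -> V (x) H_D (x) H_D
   and H_D (x) f : H_D (x) V -> H_D (x) V (x) H_D *)
Definition coactl V (f : V -> tH D V) (t : tH D V) : tHH D V :=
  [ffun ab => f (t ab.2) ab.1].
Definition coactr V (f : V -> tH D V) (t : tH D V) : tHH D V :=
  [ffun ab => f (t ab.1) ab.2].

End Coalgebra.

Section ComoduleAlgebra.
Variables (k : fieldType) (D : datum k) (B : unitAlgType k).
Implicit Types (a c : hidx D) (x y : B) (h l : HD D).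
Implicit Types (s : {linear tH D B -> tH D B}) (nu : {linear B -> tH D B}).

Record left_transposition s : Prop := LeftTransposition {
  tr_bij : bijective s;
  tr_1H : forall x, s (tens 1 x) = tens 1 x;
  tr_mulH : forall t : tHH D B, s (tmul t) = tmul (actl s (actr s t));
  tr_eps : forall t : tH D B, teps (s t) = teps t;
  tr_Delta : forall t : tH D B, tDelta (s t) = actl s (actr s (tDelta t));
  tr_braid : forall t : tHH D B,
    actl s (actr s (braid t)) = braid (actl s (actr s t));
  tr_1B : forall h, s (tens h 1) = tens h 1;
  tr_mulB : forall h x y, s (tens h (x * y)) =
    [ffun c => \sum_a s (tens h x) a * s (tens (hbas a) y) c]
}.

Record right_comodule nu : Prop := RightComodule {
  nu_coassoc : forall x, coactl nu (nu x) = tDelta (nu x);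
  nu_counit : forall x, teps (nu x) = x
}.

Record comodule_algebra s nu : Prop := ComoduleAlgebra {
  ca_tr : left_transposition s;
  ca_nu : right_comodule nu;
  ca_braid : forall t : tH D B, coactl nu (s t) = braid (actl s (coactr nu t));
  ca_mul : forall x y, nu (x * y) =
    tmul [ffun cd => \sum_a nu x a * s (tens (hbas a) (nu y cd.2)) cd.1];
  ca_1 : nu 1 = tens 1 1
}.

Definition coinv nu x : Prop := nu x = tens 1 x.

Definition conv (f g : HD D -> B) h : B :=
  \sum_ab Delta h ab *: (f (hbas ab.1) * g (hbas ab.2)).

Definition is_conv_inv (f g : {linear HD D -> B}) : Prop :=
  (forall h, conv f g h = (eps h)%:A) /\ (forall h, conv g f h = (eps h)%:A).

Record cleft_map s nu (f : {linear HD D -> B}) : Prop := CleftMap {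
  cleft_colin : forall h, nu (f h) = mapl f (Delta h);
  cleft_inv : exists g, is_conv_inv f g;
  cleft_braid : forall t : tHH D k^o, mapl f (braid t) = s (mapr f t)
}.

Definition cleft s nu : Prop := exists f, cleft_map s nu f.

(* The convolution inverse is unique when it exists. *)
Definition conv_inv (f : {linear HD D -> B}) : {linear HD D -> B} :=
  epsilon (inhabits (\0 : {linear HD D -> B})) (is_conv_inv f).

(* h -> c, for c in the coinvariants, composed with the inclusion into B *)
Definition weak_action s (f : {linear HD D -> B}) h x : B :=
  let t := actr s (tDelta (tens h x)) in
  \sum_ab f (hbas ab.1) * t ab * conv_inv f (hbas ab.2).

(* sigma (h (x) l), composed with the inclusion into B *)
Definition cocycle (f : {linear HD D -> B}) h l : B :=
  \sum_ab \sum_ab' (Delta h ab * Delta l ab') *: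
    \sum_cd braidF (ab.2, ab'.1) cd *:
      (f (hbas ab.1) * f (hbas cd.1) * conv_inv f (hbas cd.2 * hbas ab'.2)).

Definition subspace (P : B -> Prop) : Prop :=
  P 0 /\ forall (e : k) x y, P x -> P y -> P (e *: x + y).

Definition in_sum (I : finType) (A : {set I}) (P : I -> B -> Prop) x : Prop :=
  exists f : I -> B, (forall i, i \in A -> P i (f i)) /\ x = \sum_(i in A) f i.

Definition sum_direct (I : finType) (A : {set I}) (P : I -> B -> Prop) : Prop :=
  forall f : I -> B, (forall i, i \in A -> P i (f i)) ->
    \sum_(i in A) f i = 0 -> forall i, i \in A -> f i = 0.

Definition Autchiz : {set {perm dG D}} :=
  [set phi in Aut [set: dG D] |
    (phi (dz D) == dz D) && [forall g, chi (phi g) == chi g]].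

(* The values of Bgz at automorphisms outside Autchiz are irrelevant. *)
Record associated_objects s nu (Bgz : dG D -> {perm dG D} -> B -> Prop)
    (alpha : {lrmorphism B -> B}) (U : {linear B -> B}) : Prop := {
  ao_subspace : forall g zeta, zeta \in Autchiz -> subspace (Bgz g zeta);
  ao_span : forall x,
    in_sum (setX [set: dG D] Autchiz) (fun gz => Bgz gz.1 gz.2) x;
  ao_direct :
    sum_direct (setX [set: dG D] Autchiz) (fun gz => Bgz gz.1 gz.2);
  ao_alpha_bij : bijective alpha;
  ao_alpha : forall g zeta, zeta \in Autchiz -> forall x,
    Bgz g zeta x <-> exists2 y, Bgz g zeta y & x = alpha y;
  ao_U : forall g zeta, zeta \in Autchiz -> forall x,
    Bgz g zeta x -> Bgz ((dz D)^-1 * g)%g zeta (U x);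
  ao_Un : forall x, iter (dn D) U x = 0;
  ao_Ualpha : forall x, U (alpha x) = dq D *: alpha (U x);
  ao_s : forall zeta, zeta \in Autchiz -> forall x,
    in_sum [set: dG D] (Bgz^~ zeta) x ->
    forall g i, (i < dn D)%N ->
      s (tens (hG g * hX D ^+ i) x) =
      tens (hG (zeta g) * hX D ^+ i) (iter i alpha x);
  ao_nu : forall g x, in_sum Autchiz (Bgz g) x ->
    nu x = \sum_(i < dn D) (qfact (dqp D) i)^-1 *:
      tens (hG ((dz D) ^- i * g)%g * hX D ^+ i) (iter i U x)
}.

Definition unit_in (P : B -> Prop) x : Prop :=
  P x /\ exists2 y, P y & x * y = 1 /\ y * x = 1.

Definition left_basis (C : B -> Prop) (I : finType) (e : I -> B) : Prop :=
  (forall x, exists f : I -> B, (forall i, C (f i)) /\ x = \sum_i f i * e i) /\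
  (forall f : I -> B, (forall i, C (f i)) ->
    \sum_i f i * e i = 0 -> forall i, f i = 0).

End ComoduleAlgebra.

(* Main.v *)
(* The map sending g x^i to (-1)^i (qp)^(i(i-1)/2) b_x^i b_(g z^i)^-1 is the
   convolution inverse of gamma, by the vanishing of the alternating sums of
   Gaussian binomials; with
     Delta(g x^m) = sum_i [m, i] g x^i (x) g z^i x^(m-i),
   the formulas for the weak action and the cocycle follow by expansion.

   Call y grouplike of degree g when nu(y) = y (x) g.  Multiplying y on the
   right by b_h or b_h^-1 multiplies g by h or h^-1, so the coinvariance
   claims reduce to computing degrees.  Moreover
     nu(y b_x^m) = sum_i [m, i] y b_x^i (x) g z^i x^(m-i).
   By coassociativity, the coefficients of nu(b) at the highest power x^m that
   occurs are grouplike; subtracting their products with b_x^m lowers m, which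
   gives generation, and comparing highest powers gives independence. *)
Require Import Defs.
From HB Require Import structures.
From mathcomp Require Import all_boot all_order all_fingroup all_algebra.
From mathcomp Require Import zify ring.

Set Implicit Arguments.
Unset Strict Implicit.
Unset Printing Implicit Defensive.

Import GRing.Theory.
Local Open Scope ring_scope.

(** * Gaussian binomials *)

Section Gauss.
Variable k : fieldType.
Implicit Types (i j : nat) (t : k).

(** The constant coefficient is 1. Factorials can therefore be cancelled in k[X], although their
    values may vanish at a root of unity. *)
Lemma qnum_poly_neq0 j : qnum_poly k j.+1 != 0.
Proof.
rewrite /qnum_poly; apply/eqP=> /(congr1 (coefp 0)); rewrite /= coef_sum coef0.
rewrite big_ord_recl /= coefXn eqxx big1 ?addr0 => [|i _]; last by rewrite coefXn.
exact/eqP/oner_neq0.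
Qed.

Lemma qnum_polyD i j : qnum_poly k (i + j) = qnum_poly k i + 'X^i * qnum_poly k j.
Proof.
rewrite /qnum_poly big_split_ord /= mulr_sumr; congr (_ + _).
by apply: eq_bigr => l _; rewrite -exprD.
Qed.

Lemma qfact_poly0 : qfact_poly k 0 = 1.
Proof. by rewrite /qfact_poly big_nil. Qed.

Lemma qfact_polyS j : qfact_poly k j.+1 = qfact_poly k j * qnum_poly k j.+1.
Proof. by rewrite /qfact_poly big_nat_recr. Qed.

Lemma qfact_poly_neq0 j : qfact_poly k j != 0.
Proof.
elim: j => [|j IHj]; first by rewrite qfact_poly0 oner_neq0.
by rewrite qfact_polyS mulf_neq0 // qnum_poly_neq0.
Qed.

(** The Gaussian binomial through its q-Pascal rule: no division occurs, so it can be evaluated at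
    the root of unity [dqp D]. *)
Fixpoint gauss_poly i j : {poly k} :=
  match i, j with
  | _, 0 => 1
  | 0, _.+1 => 0
  | i'.+1, j'.+1 => gauss_poly i' j'.+1 + 'X^(i' - j') * gauss_poly i' j'
  end.

Lemma gauss_poly_small i j : (i < j)%N -> gauss_poly i j = 0.
Proof.
elim: i j => [|i IHi] [|j] //= ltij.
by rewrite !IHi ?mulr0 ?addr0 //; apply: ltnW.
Qed.

(** Times the factorials, the two q-Pascal terms are [qnum_poly k (i - j)] and
    ['X^(i - j) * qnum_poly k j.+1], each multiplied by [qfact_poly k i]; [qnum_polyD] adds them up
    to [qnum_poly k i.+1]. *)
Lemma gauss_polyM i j : (j <= i)%N ->
  gauss_poly i j * (qfact_poly k j * qfact_poly k (i - j)) = qfact_poly k i.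
Proof.
elim: i j => [|i IHi] [|j] //= leji; rewrite ?qfact_poly0 ?mul1r ?subn0 //.
rewrite subSS mulrDl.
have -> : 'X^(i - j) * gauss_poly i j * (qfact_poly k j.+1 * qfact_poly k (i - j))
    = 'X^(i - j) * qnum_poly k j.+1 * qfact_poly k i.
  by rewrite -(IHi j leji) qfact_polyS; ring.
have [ltji|] := ltnP j i.
  have -> : gauss_poly i j.+1 * (qfact_poly k j.+1 * qfact_poly k (i - j))
      = qnum_poly k (i - j) * qfact_poly k i.
    by rewrite -(IHi j.+1 ltji) -(subnSK ltji) (qfact_polyS (i - j.+1)); ring.
  rewrite -mulrDl -qnum_polyD qfact_polyS mulrC; congr (_ * qnum_poly k _).
  by rewrite addnS subnK.
move=> leij; have -> : j = i by apply/eqP; rewrite eqn_leq leij andbT -ltnS.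
by rewrite gauss_poly_small // mul0r add0r subnn expr0 mul1r qfact_polyS mulrC.
Qed.

Definition gauss t i j : k := (gauss_poly i j).[t].

Lemma gaussE t i j : (j <= i)%N -> qbinom t i j = gauss t i j.
Proof.
move=> leji; rewrite /qbinom /qbinom_poly -(gauss_polyM leji) mulpK //.
by rewrite mulf_neq0 ?qfact_poly_neq0.
Qed.

Lemma gauss_small t i j : (i < j)%N -> gauss t i j = 0.
Proof. by move=> ltij; rewrite /gauss gauss_poly_small ?horner0. Qed.

Lemma gaussn0 t i : gauss t i 0 = 1.
Proof. by case: i => [|i]; rewrite /gauss /= hornerC. Qed.

Lemma gaussSS t i j :
  gauss t i.+1 j.+1 = gauss t i j.+1 + t ^+ (i - j) * gauss t i j.
Proof. by rewrite /gauss /= !hornerE. Qed.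

Lemma gaussnn t i : gauss t i i = 1.
Proof.
elim: i => [|i IHi]; first exact: gaussn0.
by rewrite gaussSS gauss_small // add0r subnn expr0 mul1r.
Qed.

Lemma gauss_sub t i j : (j <= i)%N -> gauss t i (i - j) = gauss t i j.
Proof.
move=> leji; rewrite -!gaussE ?leq_subr // /qbinom /qbinom_poly.
by rewrite subKn // [X in _ %/ X]mulrC.
Qed.

(** The q-Pascal rule in summed form. It drives the inductions for the alternating sums, the powers
    of [DeltaX D] and the coaction on powers of [bx]. *)
Lemma gauss_sumS t (V : lmodType k) i (F : nat -> V) :
  \sum_(j < i.+2) gauss t i.+1 j *: F j =
  \sum_(j < i.+1) gauss t i j *: (F j + t ^+ (i - j) *: F j.+1).
Proof.
rewrite big_ord_recl gaussn0 /=.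
under eq_bigr => j _ do rewrite /bump /= add1n gaussSS scalerDl.
rewrite big_split /= addrA.
under [RHS]eq_bigr => j _ do rewrite scalerDr.
rewrite [RHS]big_split /=; congr (_ + _); last first.
  by apply: eq_bigr => j _; rewrite scalerA mulrC.
rewrite [RHS]big_ord_recl gaussn0 big_ord_recr /= gauss_small // scale0r addr0.
by [].
Qed.

(** Since C(j+1, 2) = C(j, 2) + j, passing from i to i+1 multiplies the sum by 1 - t^i. The first
    such factor, at i = 0, is zero. *)
Lemma gauss_alt_suml t i :
  \sum_(j < i.+1) gauss t i j * ((-1) ^+ j * t ^+ 'C(j, 2)) = (i == 0)%:R.
Proof.
elim: i => [|i IHi]; first by rewrite big_ord1 gaussn0 !mulr1.
rewrite (@gauss_sumS t k^o i (fun j => (-1) ^+ j * t ^+ 'C(j, 2))) /=.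
transitivity ((1 - t ^+ i) * \sum_(j < i.+1) gauss t i j * ((-1) ^+ j * t ^+ 'C(j, 2))).
  rewrite mulr_sumr; apply: eq_bigr => j _ /=.
  have -> : t ^+ i = t ^+ (i - j) * t ^+ j by rewrite -exprD subnK // -ltnS.
  rewrite binS bin1 exprD exprS; set P := gauss t i j; set Q := (-1) ^+ j.
  by rewrite -[_ *: _]/(_ * (_ + _ * _)); ring.
by rewrite IHi; case: i {IHi} => [|i]; rewrite /= ?mulr0 // expr0 subrr mul0r.
Qed.

Lemma gauss_alt_sumr t i :
  \sum_(j < i.+1) gauss t i j * ((-1) ^+ (i - j) * t ^+ 'C(i - j, 2)) = (i == 0)%:R.
Proof.
rewrite -(gauss_alt_suml t) [RHS](reindex_inj rev_ord_inj) /=.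
by apply: eq_bigr => j _; rewrite subSS gauss_sub // -ltnS.
Qed.

(** The absorption identity for Gaussian binomials, multiplied by t - 1 so that q-integers become
    t^l - 1. The factorials are cancelled before evaluation. *)
Lemma gauss_absorb t i j : (j <= i)%N ->
  gauss t i.+1 j.+1 * (t ^+ j.+1 - 1) = (t ^+ i.+1 - 1) * gauss t i j.
Proof.
move=> leji.
have qnumE l : qnum_poly k l * ('X - 1) = 'X^l - 1 by rewrite mulrC subrX1.
have hornerXn1 l : ('X^l - 1).[t] = t ^+ l - 1 by rewrite !hornerE.
suff E : gauss_poly i.+1 j.+1 * qnum_poly k j.+1 = qnum_poly k i.+1 * gauss_poly i j.
  have /(congr1 (fun P : {poly k} => (P * ('X - 1)).[t])) := E.
  by rewrite -mulrA qnumE mulrAC qnumE !hornerM !hornerXn1.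
apply: (@mulIf _ (qfact_poly k j * qfact_poly k (i - j))).
  by rewrite mulf_neq0 ?qfact_poly_neq0.
rewrite -[RHS]mulrA gauss_polyM // [RHS]mulrC -qfact_polyS.
by rewrite -(@gauss_polyM i.+1 j.+1) // qfact_polyS subSS; ring.
Qed.

(** In [gauss_absorb] with upper index n the right side is zero, whereas t^i - 1 is not. *)
Lemma gauss_prim_root t n i : n.-primitive_root t -> (0 < i < n)%N -> gauss t n i = 0.
Proof.
case: n i => [|n] [|i] // prt /andP[_ ltin].
have := @gauss_absorb t n i (ltnW ltin); rewrite (prim_expr_order prt) subrr mul0r.
move/eqP; rewrite mulf_eq0 subr_eq0 => /orP[/eqP //|].
by rewrite -(prim_order_dvd prt) gtnNdvd.
Qed.

End Gauss.

(** * Comultiplication and convolution *)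

Section Comultiplication.
Variables (k : fieldType) (D : datum k).
Local Notation n := (dn D).
Local Notation z := (dz D).
Implicit Types (g h l : dG D) (i j m : nat) (a c : hidx D) (u v w : HD D).

Lemma dn_gt0 : (0 < n)%N. Proof. exact: ltnW (dn_gt1 D). Qed.

(** [F] takes natural exponents instead of ordinals, so that computed exponents such as m - i can be
    substituted. *)
Lemma sum_hvec (V : lmodType k) (F : dG D -> nat -> V) g i : (i < n)%N ->
  \sum_a hvec (D:=D) g i a *: F a.1 a.2 = F g i.
Proof.
move=> ltin; rewrite (bigD1 (g, Ordinal ltin)) //= ffunE /= !eqxx scale1r.
rewrite big1 ?addr0 // => -[h j] /=; rewrite xpair_eqE -val_eqE /= ffunE /=.
by move/negPf=> ->; rewrite scale0r.
Qed.

Lemma sum_htens (V : lmodType k) (F : dG D -> nat -> dG D -> nat -> V) g i h j :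
  (i < n)%N -> (j < n)%N ->
  \sum_ab htens (hvec (D:=D) g i) (hvec h j) ab *: F ab.1.1 ab.1.2 ab.2.1 ab.2.2
  = F g i h j.
Proof.
move=> ltin ltjn; rewrite -(sum_hvec (fun g' i' => F g' i' h j) g ltin).
under [RHS]eq_bigr => a _ do rewrite -(sum_hvec (F a.1 a.2) h ltjn) scaler_sumr.
rewrite pair_bigA /=; apply: eq_bigr => ab _.
by rewrite scalerA /htens ffunE.
Qed.

Lemma sum_braidF (V : lmodType k) (F : dG D -> nat -> dG D -> nat -> V) a c :
  \sum_cd braidF (a, c) cd *: F cd.1.1 cd.1.2 cd.2.1 cd.2.2 =
  dq D ^+ (a.2 * c.2) *: F c.1 c.2 a.1 a.2.
Proof.
rewrite -(sum_htens F c.1 a.1 (ltn_ord c.2) (ltn_ord a.2)) scaler_sumr.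
by apply: eq_bigr => cd _; rewrite scalerA /braidF ffunE.
Qed.

Lemma htensZr (e : k) u v : htens u (e *: v) = e *: htens u v.
Proof. by apply/ffunP=> ab; rewrite !ffunE; apply: mulrCA. Qed.

Lemma bmulE (t t' : tHH D k^o) : bmul t t' =
  \sum_ab t ab *: \sum_ab' t' ab' *: (dq D ^+ (ab.2.2 * ab'.1.2) *:
     htens (hbas ab.1 * hbas ab'.1) (hbas ab.2 * hbas ab'.2)).
Proof.
apply: eq_bigr => ab _; rewrite scaler_sumr; apply: eq_bigr => ab' _.
rewrite scalerA; congr (_ *: _).
exact: (sum_braidF (fun h j h' j' =>
  htens (hbas ab.1 * hvec h j) (hvec h' j' * hbas ab'.2))).
Qed.

Lemma bmul_suml (I : finType) (e : I -> k) (F : I -> tHH D k^o) t :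
  bmul (\sum_i e i *: F i) t = \sum_i e i *: bmul (F i) t.
Proof.
rewrite bmulE.
under eq_bigr => ab _ do rewrite sum_ffunE scaler_suml.
rewrite exchange_big /=; apply: eq_bigr => i _; rewrite bmulE scaler_sumr.
by apply: eq_bigr => ab _; rewrite ffunE scalerA.
Qed.

Lemma bmulDr t t1 t2 : bmul t (t1 + t2 : tHH D k^o) = bmul t t1 + bmul t t2.
Proof.
rewrite !bmulE -big_split; apply: eq_bigr => ab _ /=.
rewrite -scalerDr -big_split.
by congr (_ *: _); apply: eq_bigr => ab' _; rewrite ffunE scalerDl.
Qed.

Lemma bmul_htens g i h j g' i' h' j' :
  (i < n)%N -> (j < n)%N -> (i' < n)%N -> (j' < n)%N ->
  bmul (htens (hvec g i) (hvec h j)) (htens (hvec g' i') (hvec h' j')) =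
  dq D ^+ (j * i') *: htens (hvec g i * hvec g' i') (hvec h j * hvec h' j').
Proof.
move=> ltin ltjn ltin' ltjn'; rewrite bmulE.
rewrite (sum_htens (fun g i h j => \sum_ab' htens (hvec g' i') (hvec h' j') ab' *:
  (dq D ^+ (j * ab'.1.2) *: htens (hvec g i * hbas ab'.1) (hvec h j * hbas ab'.2)))) //.
exact: (sum_htens (fun g' i' h' j' =>
  dq D ^+ (j * i') *: htens (hvec g i * hvec g' i') (hvec h j * hvec h' j'))).
Qed.

Lemma hvecM_lo g i h j : (i + j < n)%N ->
  hvec g i * hvec h j = chi h ^+ i *: hvec (g * h)%g (i + j) :> HD D.
Proof.
move=> lt; rewrite [LHS]hmul_vec ?hred_lo //; apply: leq_ltn_trans lt.
  exact: leq_addr.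
exact: leq_addl.
Qed.

(** Multiplying by x (x) z moves x past x^(m-i), at the cost q^(m-i), and then x^(m-i) past z, at
    the cost chi(z)^(m-i). The product (qp)^(m-i) is the weight in [gauss_sumS]. *)
Lemma iter_DeltaX g m : (m < n)%N ->
  iter m (fun t => bmul t (DeltaX D)) (htens (hG g) (hG g)) =
  \sum_(i < m.+1) gauss (dqp D) m i *:
    htens (hvec g i) (hvec (g * z ^+ i)%g (m - i)).
Proof.
elim: m => [_|m IHm ltmn].
  by rewrite big_ord1 gaussn0 scale1r mulg1.
rewrite iterS IHm 1?ltnW // bmul_suml.
rewrite (gauss_sumS _ m (fun i => htens (hvec g i) (hvec (g * z ^+ i)%g (m.+1 - i)))).
apply: eq_bigr => i _; congr (_ *: _).
have leim : (i <= m)%N by rewrite -ltnS.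
have ltin := leq_ltn_trans leim (ltnW ltmn).
have ltmin := leq_ltn_trans (leq_subr i m) (ltnW ltmn).
have n0 := dn_gt0; have n1 := dn_gt1 D.
rewrite bmulDr !bmul_htens // !hvecM_lo ?addn0 ?addn1 //; last 2 first.
- exact: leq_ltn_trans ltmn.
- by apply: leq_ltn_trans ltmn; rewrite ltnS leq_subr.
rewrite muln0 muln1 expr0 !chi1 !expr1n !scale1r !mulg1 -subSn //.
rewrite htensZr scalerA -exprMn subSS expgSr mulgA.
by [].
Qed.

Lemma Delta_hvec g m : (m < n)%N ->
  Delta (hvec g m) = \sum_(i < m.+1) gauss (dqp D) m i *:
    htens (hvec g i) (hvec (g * z ^+ i)%g (m - i)) :> tHH D k^o.
Proof.
move=> ltmn; rewrite -iter_DeltaX //.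
exact: (sum_hvec (fun g m => iter m (fun t => bmul t (DeltaX D)) (htens (hG g) (hG g)))).
Qed.

Lemma sum_Delta (V : lmodType k) (F : dG D -> nat -> dG D -> nat -> V) g m :
  (m < n)%N ->
  \sum_ab Delta (hvec g m) ab *: F ab.1.1 ab.1.2 ab.2.1 ab.2.2 =
  \sum_(i < m.+1) gauss (dqp D) m i *: F g i (g * z ^+ i)%g (m - i)%N.
Proof.
move=> ltmn; rewrite Delta_hvec //.
under eq_bigr => ab _ do rewrite sum_ffunE scaler_suml.
rewrite exchange_big /=; apply: eq_bigr => i _.
have leim : (i <= m)%N by rewrite -ltnS.
rewrite -(@sum_htens V F g i) ?(leq_ltn_trans _ ltmn) ?leq_subr //.
by rewrite scaler_sumr; apply: eq_bigr => ab _; rewrite ffunE scalerA.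
Qed.

Lemma eps_hvec g m : (m < n)%N -> eps (hvec (D:=D) g m) = (m == 0%N)%:R.
Proof. by move=> ltmn; apply: (@sum_hvec k^o (fun _ i => (i == 0%N)%:R)). Qed.

End Comultiplication.

Section Convolution.
Variables (k : fieldType) (D : datum k) (B : unitAlgType k).
Local Notation n := (dn D).
Local Notation z := (dz D).
Implicit Types (g h : dG D) (m : nat) (u : HD D) (f : {linear HD D -> B}).

(** Supplies the bundled linear map that [is_conv_inv] demands when values are prescribed on the
    basis only. *)
Definition ext_lin (F : dG D -> nat -> B) (u : HD D) : B :=
  \sum_a u a *: F a.1 a.2.

Fact ext_lin_is_linear F : linear (ext_lin F).
Proof.
move=> e u v; rewrite /ext_lin scaler_sumr -big_split; apply: eq_bigr => a _ /=.
by rewrite !ffunE scalerDl scalerA.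
Qed.

HB.instance Definition _ F :=
  GRing.isLinear.Build k (HD D) B _ (ext_lin F) (ext_lin_is_linear F).

Lemma ext_lin_hvec F g m : (m < n)%N -> ext_lin F (hvec g m) = F g m.
Proof. exact: sum_hvec. Qed.

Lemma conv_hvec f f' g m : (m < n)%N ->
  conv f f' (hvec g m) = \sum_(i < m.+1) gauss (dqp D) m i *:
    (f (hvec g i) * f' (hvec (g * z ^+ i)%g (m - i))).
Proof.
move=> ltmn.
exact: (sum_Delta (fun g i h j => f (hvec g i) * f' (hvec h j))).
Qed.

Lemma conv_sum f f' u : conv f f' u = \sum_a u a *: conv f f' (hbas a).
Proof.
have DE : Delta u = \sum_a u a *: Delta (hbas a).
  apply: eq_bigr => a _; congr (_ *: _).
  by rewrite Delta_hvec // -iter_DeltaX.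
rewrite /conv DE.
under eq_bigr => ab _ do rewrite sum_ffunE scaler_suml.
rewrite exchange_big /=; apply: eq_bigr => a _; rewrite [RHS]scaler_sumr.
by apply: eq_bigr => ab _; rewrite ffunE scalerA.
Qed.

Lemma eps_sum (u : HD D) : (eps u)%:A = \sum_a u a *: (eps (hbas a))%:A :> B.
Proof.
rewrite {1}/eps scaler_suml; apply: eq_bigr => a _.
by rewrite [eps (hbas a)]eps_hvec // scalerA.
Qed.

Lemma conv_eps f f' :
  (forall g m, (m < n)%N -> conv f f' (hvec g m) = (m == 0)%:R) ->
  forall u, conv f f' u = (eps u)%:A.
Proof.
move=> ff' u; rewrite conv_sum eps_sum; apply: eq_bigr => a _.
rewrite ff' // [eps (hbas a)]eps_hvec //.
by case: (_ == _); rewrite ?scale1r ?scale0r.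
Qed.

(* Comparing the terms with x^m entirely on the right determines f'(g x^m)
   from the values of f' at lower powers of x. *)
Lemma conv_inv_uniq f f1 f2 : (forall g, f (hvec g 0) \is a GRing.unit) ->
  (forall u, conv f f1 u = conv f f2 u) ->
  forall g m, (m < n)%N -> f1 (hvec g m) = f2 (hvec g m).
Proof.
move=> fU f12 g m; elim/ltn_ind: m g => m IHm g ltmn.
have := f12 (hvec g m); rewrite !conv_hvec // !big_ord_recl /= gaussn0 !scale1r.
under eq_bigr => i _.
  rewrite IHm; first over.
  - by rewrite /bump /= add1n ltn_subrL /= (leq_ltn_trans _ (ltn_ord i)).
  by rewrite (leq_ltn_trans _ ltmn) // leq_subr.
by move/addIr; rewrite subn0 mulg1; apply: mulrI.
Qed.

(** * The convolution inverse of the cleft map *)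

Variables (b : dG D -> B) (bx : B) (gamma : {linear HD D -> B}).
Hypothesis b_unit : forall g, b g \is a GRing.unit.
Hypothesis gammaE : forall g i, (i < n)%N ->
  gamma (hG g * hX D ^+ i) = b g * bx ^+ i.

Lemma gamma_hvec g i : (i < n)%N -> gamma (hvec g i) = b g * bx ^+ i.
Proof. by move=> ltin; rewrite hvecE ?gammaE. Qed.

Definition gamma_inv_hvec g m : B :=
  ((-1) ^+ m * dqp D ^+ 'C(m, 2)) *: (bx ^+ m * (b (g * z ^+ m)%g)^-1).

(** In either order the B-part is the same in all terms: b_g b_x^m b_(gz^m)^-1 on one side, and
    b_x^m on the other, where b_(gz^i)^-1 meets b_(gz^i). An alternating Gaussian sum remains as the
    scalar. *)
Lemma gamma_inv_is_conv_inv : is_conv_inv gamma (ext_lin gamma_inv_hvec).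
Proof.
have E g i m : (i <= m)%N -> (g * z ^+ i * z ^+ (m - i) = g * z ^+ m)%g.
  by move=> leim; rewrite -mulgA -expgD subnKC.
split; apply: conv_eps => g m ltmn; rewrite conv_hvec //.
- transitivity ((\sum_(i < m.+1) gauss (dqp D) m i *
     ((-1) ^+ (m - i) * dqp D ^+ 'C(m - i, 2))) *: (b g * bx ^+ m * (b (g * z ^+ m)%g)^-1)).
    rewrite scaler_suml; apply: eq_bigr => i _.
    have leim : (i <= m)%N by rewrite -ltnS.
    rewrite /= ext_lin_hvec ?(leq_ltn_trans (leq_subr _ _)) //.
    rewrite gamma_hvec ?(leq_ltn_trans leim) // /gamma_inv_hvec E //.
    rewrite -scalerAr scalerA; congr (_ *: _).
    by rewrite mulrA -(mulrA (b g) (bx ^+ i)) -exprD subnKC.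
  rewrite gauss_alt_sumr; case: eqP => [->|_]; last by rewrite scale0r.
  by rewrite scale1r expr0 mulr1 expg0 mulg1 divrr.
transitivity ((\sum_(i < m.+1) gauss (dqp D) m i *
     ((-1) ^+ i * dqp D ^+ 'C(i, 2))) *: bx ^+ m).
  rewrite scaler_suml; apply: eq_bigr => i _.
  have leim : (i <= m)%N by rewrite -ltnS.
  rewrite /= ext_lin_hvec ?(leq_ltn_trans leim) //.
  rewrite gamma_hvec ?(leq_ltn_trans (leq_subr _ _)) // /gamma_inv_hvec.
  by rewrite -scalerAl scalerA -mulrA mulKr // -exprD subnKC.
rewrite gauss_alt_suml; case: eqP => [->|_]; last by rewrite scale0r.
by rewrite scale1r expr0.
Qed.

(** [conv_inv] is a choice, known only by its specification: the explicit inverse shows that the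
    choice succeeds, and uniqueness gives its values. *)
Lemma conv_inv_hvec g m : (m < n)%N ->
  conv_inv gamma (hvec g m) = gamma_inv_hvec g m.
Proof.
move=> ltmn; rewrite -(ext_lin_hvec _ g ltmn).
have [ci _] : is_conv_inv gamma (conv_inv gamma).
  apply: ClassicalEpsilon.epsilon_spec.
  by exists (ext_lin gamma_inv_hvec); apply: gamma_inv_is_conv_inv.
apply: (conv_inv_uniq (f := gamma)) => // [h|u].
  by rewrite gamma_hvec ?dn_gt0 // expr0 mulr1.
by rewrite ci (proj1 gamma_inv_is_conv_inv).
Qed.

End Convolution.

(** * Weak action and cocycle *)

Section ActionCocycle.
Variables (k : fieldType) (D : datum k) (B : unitAlgType k).
Local Notation n := (dn D).
Local Notation z := (dz D).
Implicit Types (g h : dG D) (m r : nat) (u : HD D).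
Variables (b : dG D -> B) (bx : B) (gamma : {linear HD D -> B}).
Hypothesis b_unit : forall g, b g \is a GRing.unit.
Hypothesis gammaE : forall g i, (i < n)%N ->
  gamma (hG g * hX D ^+ i) = b g * bx ^+ i.

Lemma zX_central g i : (z ^+ i * g = g * z ^+ i)%g.
Proof. exact/esym/commuteX/commute_sym/dz_central. Qed.

Lemma tDelta_tens (V : lmodType k) u (x : V) ab :
  tDelta (tens u x) ab = Delta u ab *: x.
Proof.
rewrite /tDelta /extV ffunE /Delta sum_ffunE scaler_suml.
by apply: eq_bigr => a _; rewrite !ffunE scalerA mulrC.
Qed.

(** [F j] stands for alpha^j(c): all that enters about [s] is how basis elements pass [x]. *)
Lemma weak_action_hvec (s : {linear tH D B -> tH D B}) (zeta : dG D -> dG D)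
    (x : B) (F : nat -> B) g m : (m < n)%N ->
  (forall h j, (j < n)%N -> s (tens (hvec h j) x) = tens (hvec (zeta h) j) (F j)) ->
  weak_action s gamma (hvec g m) x =
  \sum_(i < m.+1) gauss (dqp D) m i *: (gamma (hvec g i) * F (m - i)%N *
    conv_inv gamma (hvec (zeta (g * z ^+ i)%g) (m - i))).
Proof.
move=> ltmn sE; rewrite /weak_action.
have tE (ab : hidx D * hidx D) : actr s (tDelta (tens (hvec g m) x)) ab =
    \sum_(i < m.+1) (gauss (dqp D) m i *
      htens (hvec g i) (hvec (zeta (g * z ^+ i)%g) (m - i)) ab) *: F (m - i)%N.
  rewrite /actr ffunE.
  have -> : [ffun c => tDelta (tens (hvec g m) x) (ab.1, c)] =
      \sum_(i < m.+1) (gauss (dqp D) m i * hvec g i ab.1) *: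
        tens (hvec (g * z ^+ i)%g (m - i)) x.
    apply/ffunP=> c; rewrite ffunE tDelta_tens Delta_hvec // !sum_ffunE scaler_suml.
    apply: eq_bigr => i _; rewrite !ffunE !scalerA.
    by congr (_ *: _); rewrite -mulrA.
  rewrite linear_sum sum_ffunE. apply: eq_bigr => i _ /=.
  rewrite linearZ ffunE sE ?(leq_ltn_trans (leq_subr _ _)) //.
  by rewrite !ffunE scalerA -mulrA.
under eq_bigr => ab _ do rewrite tE mulr_sumr mulr_suml.
rewrite exchange_big /=; apply: eq_bigr => i _.
have leim : (i <= m)%N by rewrite -ltnS.
rewrite -(@sum_htens k D B (fun h i' h' j =>
  gamma (hvec h i') * F (m - i)%N * conv_inv gamma (hvec h' j))).
- rewrite scaler_sumr; apply: eq_bigr => ab _.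
  by rewrite -scalerAr -scalerAl scalerA.
- exact: leq_ltn_trans ltmn.
exact: leq_ltn_trans (leq_subr _ _) ltmn.
Qed.

(** The power of q comes from the braid moving x^(m-i) past x^j. The product inside [conv_inv] stays
    unreduced, as its exponent may reach n. *)
Lemma cocycle_hvec g h m r : (m < n)%N -> (r < n)%N ->
  cocycle gamma (hvec g m) (hvec h r) =
  \sum_(i < m.+1) \sum_(j < r.+1)
    (gauss (dqp D) m i * gauss (dqp D) r j * dq D ^+ ((m - i) * j)) *:
    (gamma (hvec g i) * gamma (hvec h j) *
     conv_inv gamma (hvec (g * z ^+ i)%g (m - i) * hvec (h * z ^+ j)%g (r - j))).
Proof.
move=> ltmn ltrn; rewrite /cocycle.
under eq_bigr => ab _.
  under eq_bigr => ab' _.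
    rewrite (sum_braidF (fun g1 i1 g2 i2 => gamma (hbas ab.1) * gamma (hvec g1 i1) *
      conv_inv gamma (hvec g2 i2 * hbas ab'.2))) -scalerA.
    over.
  rewrite -scaler_sumr.
  rewrite (sum_Delta (fun g1 i1 g2 i2 => dq D ^+ (ab.2.2 * i1) *:
    (gamma (hbas ab.1) * gamma (hvec g1 i1) *
     conv_inv gamma (hvec ab.2.1 ab.2.2 * hvec g2 i2)))) //.
  over.
rewrite (sum_Delta (fun g0 i0 g' i' => \sum_(j < r.+1) gauss (dqp D) r j *:
    (dq D ^+ (i' * j) *: (gamma (hvec g0 i0) * gamma (hvec h j) *
     conv_inv gamma (hvec g' i' * hvec (h * z ^+ j)%g (r - j)))))) //.
apply: eq_bigr => i _; rewrite scaler_sumr; apply: eq_bigr => j _.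
by rewrite !scalerA mulrA.
Qed.

Lemma muln_subn1_half m : (m * (m - 1) %/ 2)%N = 'C(m, 2).
Proof. by rewrite bin2 divn2 subn1. Qed.

(** The last hypothesis expresses that [zeta] fixes z; it makes the index zeta(g z^i) z^(m-i) equal
    to zeta(g) z^m, whatever i is. *)
Lemma weak_action_formula (s : {linear tH D B -> tH D B}) (zeta : dG D -> dG D)
    (x : B) (F : nat -> B) g m : (m < n)%N ->
  (forall h j, (j < n)%N -> s (tens (hG h * hX D ^+ j) x) =
     tens (hG (zeta h) * hX D ^+ j) (F j)) ->
  (forall j, zeta (g * z ^+ j)%g = (zeta g * z ^+ j)%g) ->
  weak_action s gamma (hG g * hX D ^+ m) x =
  \sum_(j < m.+1)
    ((-1) ^+ j * dqp D ^+ (j * (j - 1) %/ 2) * qbinom (dqp D) m j) *: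
      (b g * bx ^+ (m - j) * F j * bx ^+ j * (b (zeta g * z ^+ m)%g)^-1).
Proof.
move=> ltmn sE zetaz; rewrite -hvecE //.
rewrite (@weak_action_hvec s zeta x F) // => [|h j ltjn]; last by rewrite !hvecE // sE.
(* The index from [Delta] counts the factors x on the left, that of the formula those on the
   right. *)
rewrite [RHS](reindex_inj rev_ord_inj); apply: eq_bigr => i _ /=.
have leim : (i <= m)%N by rewrite -ltnS.
have ltin := leq_ltn_trans leim ltmn.
have ltmin := leq_ltn_trans (leq_subr i m) ltmn.
rewrite subSS subKn // gaussE ?leq_subr // gauss_sub //.
rewrite (gamma_hvec gammaE) // (conv_inv_hvec b_unit gammaE) // /gamma_inv_hvec.
rewrite zetaz -mulgA -expgD subnKC // muln_subn1_half -scalerAr scalerA !mulrA.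
by congr (_ *: _); rewrite -mulrA mulrC.
Qed.

(** The terms of [cocycle_hvec] are split by whether x^(m-i) x^(r-j) stays below x^n. If not, x^n =
    lam (z^n - 1) yields one term in each of the last two sums. *)
Lemma cocycle_formula g h m r : (m < n)%N -> (r < n)%N ->
  cocycle gamma (hG g * hX D ^+ m) (hG h * hX D ^+ r) =
  \sum_(i < m.+1) \sum_(j < r.+1 | (m + r - i - j < dn D)%N)
    (let xi := (m + r - i - j)%N in
     (-1) ^+ xi * qbinom (dqp D) m i * qbinom (dqp D) r j
     * dqp D ^+ (xi * (xi - 1) %/ 2 + m * j - i * j) * chi h ^+ (m - i)) *:
      (b g * bx ^+ i * b h * bx ^+ (m + r - i)
       * (b (g * h * dz D ^+ (m + r))%g)^-1)
  + lam D *: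
    \sum_(i < m.+1) \sum_(j < r.+1 | (dn D <= m + r - i - j)%N)
    (let xi' := (m + r - i - j - dn D)%N in
     (-1) ^+ xi' * qbinom (dqp D) m i * qbinom (dqp D) r j
     * dqp D ^+ (xi' * (xi' - 1) %/ 2 + m * j - i * j) * chi h ^+ (m - i)) *:
      (b g * bx ^+ i * b h * bx ^+ (m + r - i - dn D)
       * (b (g * h * dz D ^+ (m + r))%g)^-1)
  - lam D *:
    \sum_(i < m.+1) \sum_(j < r.+1 | (dn D <= m + r - i - j)%N)
    (let xi' := (m + r - i - j - dn D)%N in
     (-1) ^+ xi' * qbinom (dqp D) m i * qbinom (dqp D) r j
     * dqp D ^+ (xi' * (xi' - 1) %/ 2 + m * j - i * j) * chi h ^+ (m - i)) *:
      (b g * bx ^+ i * b h * bx ^+ (m + r - i - dn D)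
       * (b (g * h * dz D ^+ (m + r - dn D))%g)^-1).
Proof.
move=> ltmn ltrn; rewrite -!hvecE // cocycle_hvec //.
rewrite !scaler_sumr -big_split -sumrB; apply: eq_bigr => i _ /=.
rewrite !scaler_sumr -addrA -sumrB.
rewrite (bigID (fun j : 'I_r.+1 => m + r - i - j < n)%N) /=.
have leim : (i <= m)%N by rewrite -ltnS.
have ltin := leq_ltn_trans leim ltmn.
have ltmin := leq_ltn_trans (leq_subr i m) ltmn.
(* The braid factor q^((m-i)j) and chi(z^j)^(m-i) merge into (qp)^(mj-ij); the truncated subtraction
   is exact because i <= m. *)
have coefE (j xi : nat) :
    dq D ^+ ((m - i) * j) * chi (h * z ^+ j)%g ^+ (m - i) * dqp D ^+ 'C(xi, 2) =
    dqp D ^+ (xi * (xi - 1) %/ 2 + m * j - i * j) * chi h ^+ (m - i).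
  rewrite muln_subn1_half -addnBA ?leq_mul2r ?leim ?orbT // -mulnBl exprD.
  rewrite chiM chiX exprMn -exprM [(j * _)%N]mulnC [dqp D ^+ (_ * _)]exprMn.
  by rewrite /dp; ring.
have vecE (j xi e : nat) y : (j + xi = e)%N ->
    b g * bx ^+ i * (b h * bx ^+ j) * (bx ^+ xi * y) =
    b g * bx ^+ i * b h * bx ^+ e * y.
  by move=> <-; rewrite exprD !mulrA.
have grpE (j : nat) : (g * z ^+ i * (h * z ^+ j) = g * h * z ^+ (i + j))%g.
  by rewrite -mulgA [(z ^+ i * (h * _))%g]mulgA zX_central expgD !mulgA.
have xiE (j : 'I_r.+1) : (m - i + (r - j) = m + r - i - j)%N.
  by have := ltn_ord j; lia.
congr (_ + _); last apply: eq_big => [j|j]; rewrite -?leqNgt //.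
- apply: eq_bigr => j ltxi.
  have lejr : (j <= r)%N by rewrite -ltnS.
  have ltjn := leq_ltn_trans lejr ltrn.
  have ltrjn := leq_ltn_trans (leq_subr j r) ltrn.
  rewrite [hvec _ _ * hvec _ _]hmul_vec // xiE hred_lo // linearZ /=.
  rewrite !(gamma_hvec gammaE) // (conv_inv_hvec b_unit gammaE) // /gamma_inv_hvec.
  rewrite grpE -mulgA -expgD -!scalerAr !scalerA.
  rewrite (vecE _ _ (m + r - i)%N); last by lia.
  have -> : (i + j + (m + r - i - j) = m + r)%N by lia.
  congr (_ *: _); rewrite -[_ * _ * chi h ^+ (m - i)]mulrA -coefE !gaussE //; ring.
move=> lexi.
have lejr : (j <= r)%N by rewrite -ltnS.
have ltjn := leq_ltn_trans lejr ltrn.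
have ltrjn := leq_ltn_trans (leq_subr j r) ltrn.
(* A single reduction suffices: the remaining exponent is below n, as both m and r are. *)
have ltxi : (m + r - i - j - n < n)%N by lia.
rewrite [hvec _ _ * hvec _ _]hmul_vec // xiE hred_hi // !linearZ linearB /=.
rewrite !(gamma_hvec gammaE) // !(conv_inv_hvec b_unit gammaE) // /gamma_inv_hvec.
rewrite grpE -!mulgA -!expgD -!scalerAr mulrBr -!scalerAr !(scalerBr, scalerN, scalerA).
rewrite !(vecE _ _ (m + r - i - n)%N); [|lia|lia].
(* The summand z^n restores the full power z^(m+r); the summand -1 leaves z^(m+r-n). *)
have -> : (i + j + (n + (m + r - i - j - n)) = m + r)%N by lia.
have -> : (i + j + (m + r - i - j - n) = m + r - n)%N by lia.
by congr (_ *: _ - _ *: _); rewrite -[_ * _ * chi h ^+ (m - i)]mulrA -coefE !gaussE //; ring.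
Qed.

End ActionCocycle.

(** * Grouplike elements and the basis *)

Section Coaction.
Variables (k : fieldType) (D : datum k) (B : unitAlgType k).
Local Notation n := (dn D).
Local Notation z := (dz D).
Implicit Types (g h : dG D) (i j m : nat) (a c : hidx D) (u v w : HD D).
Implicit Types (x y : B) (t : tH D B).

Lemma hXnG j g : hX D ^+ j * hG g = chi g ^+ j *: (hG g * hX D ^+ j).
Proof.
elim: j => [|j IHj]; first by rewrite !expr0 mulr1 mul1r scale1r.
rewrite exprSr -mulrA hXG -scalerAr.
  rewrite (mulrA (hX D ^+ j)) IHj -scalerAl scalerA -exprS.
by rewrite -mulrA -exprSr.
Qed.

Fact tens_is_linear u : linear (@tens k D B u).
Proof.
by move=> e x y; apply/ffunP=> a; rewrite !ffunE scalerDr !scalerA mulrC.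
Qed.

HB.instance Definition _ u :=
  GRing.isLinear.Build k B (tH D B) _ (@tens k D B u) (tens_is_linear u).

Lemma tensZl (e : k) u x : tens (e *: u) x = e *: tens u x.
Proof. by apply/ffunP=> a; rewrite !ffunE [RHS]scalerA. Qed.

Lemma tens_sum t : t = \sum_a tens (hbas a) (t a).
Proof.
apply/ffunP=> c; rewrite sum_ffunE (bigD1 c) //= ffunE hvec_idx eqxx scale1r.
rewrite big1 ?addr0 // => a ac.
by rewrite ffunE hvec_idx eq_sym (negPf ac) scale0r.
Qed.

(** Untwisted right multiplication by y (x) v, which is what the braided product becomes when [s]
    passes y unchanged. *)
Definition rmul v y t : tH D B := \sum_a tens (hbas a * v) (t a * y).

Fact rmul_is_linear v y : linear (rmul v y).
Proof.
move=> e t t'; rewrite /rmul scaler_sumr -big_split; apply: eq_bigr => a _ /=.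
by rewrite -linearP !ffunE mulrDl scalerAl.
Qed.

HB.instance Definition _ v y :=
  GRing.isLinear.Build k (tH D B) (tH D B) _ (rmul v y) (rmul_is_linear v y).

Lemma rmul_tens v y u x : rmul v y (tens u x) = tens (u * v) (x * y).
Proof.
rewrite /rmul {2}(hvec_sum u) mulr_suml.
apply/ffunP=> c; rewrite ffunE !sum_ffunE scaler_suml; apply: eq_bigr => a _.
rewrite -scalerAl !ffunE -scalerAl !scalerA; congr (_ *: _).
exact: mulrC.
Qed.

Lemma rmul_rmul v y v' y' t : rmul v' y' (rmul v y t) = rmul (v * v') (y * y') t.
Proof.
rewrite {2}/rmul linear_sum; apply: eq_bigr => a _.
by rewrite /= rmul_tens !mulrA.
Qed.

Lemma rmul11 t : rmul 1 1 t = t.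
Proof.
by rewrite [RHS]tens_sum; apply: eq_bigr => a _; rewrite !mulr1.
Qed.

(* Passing a basis element g x^i to the right of [bx] multiplies by q^i. *)
Definition twist t : tH D B := [ffun a : hidx D => dq D ^+ a.2 *: t a].

Fact twist_is_linear : linear twist.
Proof.
move=> e t t'; apply/ffunP=> a.
by rewrite !ffunE scalerDr !scalerA mulrC.
Qed.

HB.instance Definition _ :=
  GRing.isLinear.Build k (tH D B) (tH D B) _ twist twist_is_linear.

Lemma twist_tens g i x : twist (tens (hvec g i) x) = dq D ^+ i *: tens (hvec g i) x.
Proof.
apply/ffunP=> a; rewrite !ffunE; case: andP => [[_ /eqP->] //|_].
by rewrite scale0r !scaler0.
Qed.

Lemma tmul_tens u v x :
  tmul [ffun cd : hidx D * hidx D => (u cd.1 * v cd.2) *: x] = tens (u * v) x.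
Proof.
apply/ffunP=> c; rewrite !ffunE [u * v]/(hmul u v) /hmul pair_bigA sum_ffunE.
rewrite scaler_suml; apply: eq_bigr => ab _.
rewrite ffunE scalerA /mulF [hbas _ * hbas _]hmul_idx; congr (_ *: _).
by rewrite [RHS]ffunE [LHS]mulrC.
Qed.

Lemma tmulD (t1 t2 : tHH D B) : tmul (t1 + t2) = tmul t1 + tmul t2.
Proof.
apply/ffunP=> c; rewrite !ffunE -big_split; apply: eq_bigr => ab _ /=.
by rewrite ffunE scalerDr.
Qed.

Lemma tmul_suml (I : finType) (F : I -> tHH D B) :
  tmul (\sum_i F i) = \sum_i tmul (F i).
Proof.
apply: (big_morph (@tmul k D B)) => [x y|]; first exact: tmulD.
by apply/ffunP=> c; rewrite !ffunE big1 // => ab _; rewrite ffunE scaler0.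
Qed.

Variables (s : {linear tH D B -> tH D B}) (nu : {linear B -> tH D B}).

(* (mu (x) mu) o (B (x) s (x) H), the product of B (x) H_D *)
Definition tprod t t' : tH D B :=
  tmul [ffun cd => \sum_a t a * s (tens (hbas a) (t' cd.2)) cd.1].

Lemma tprodDr t t1 t2 : tprod t (t1 + t2) = tprod t t1 + tprod t t2.
Proof.
rewrite /tprod -tmulD; congr tmul; apply/ffunP=> cd; rewrite !ffunE -big_split.
by apply: eq_bigr => a _; rewrite /= !linearD ffunE mulrDr.
Qed.

(** If [s] only rescales basis elements when they pass y, the braided product is [rmul] after
    rescaling coordinates. The scalar is 1 for [b g] and for 1, and q^i for [bx]. *)
Lemma tprod_tens t v y (e : hidx D -> k) :
  (forall a, s (tens (hbas a) y) = e a *: tens (hbas a) y) ->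
  tprod t (tens v y) = rmul v y [ffun a => e a *: t a].
Proof.
move=> sE; rewrite /tprod /rmul.
under [RHS]eq_bigr => a _ do rewrite -tmul_tens.
rewrite -tmul_suml; congr tmul; apply/ffunP=> cd; rewrite sum_ffunE ffunE.
apply: eq_bigr => a _; rewrite !ffunE linearZ linearZ sE !ffunE /=.
rewrite -!scalerAr -!scalerAl !scalerA; congr (_ *: _).
by rewrite mulrC mulrA.
Qed.

Definition grouplike g y : Prop := nu y = tens (hG g) y.

(** The values of [s] and [nu] assumed below are derived from the associated objects in the final
    proof. *)
Hypothesis hB : comodule_algebra s nu.
Variables (b : dG D -> B) (bx : B).
Hypothesis b_unit : forall g, b g \is a GRing.unit.
Hypothesis s_b : forall a g, s (tens (hbas a) (b g)) = tens (hbas a) (b g).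
Hypothesis s_bx : forall a,
  s (tens (hbas a) bx) = dq D ^+ a.2 *: tens (hbas a) bx.
Hypothesis nu_b : forall g, grouplike g (b g).
Hypothesis nu_bx : nu bx = tens (hG z) bx + tens (hX D) 1.

Lemma nu_mul x y : nu (x * y) = tprod (nu x) (nu y).
Proof. exact: ca_mul hB x y. Qed.

Lemma nu_mulb x g : nu (x * b g) = rmul (hG g) (b g) (nu x).
Proof.
rewrite nu_mul nu_b (@tprod_tens _ _ _ (fun=> 1)) => [|a]; last by rewrite scale1r.
by congr rmul; apply/ffunP=> a; rewrite ffunE scale1r.
Qed.

Lemma nu_mulbx x :
  nu (x * bx) = rmul (hG z) bx (twist (nu x)) + rmul (hX D) 1 (nu x).
Proof.
rewrite nu_mul nu_bx tprodDr (tprod_tens _ _ s_bx) (@tprod_tens _ _ _ (fun=> 1)).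
  by congr (_ + rmul _ _ _); apply/ffunP=> a; rewrite ffunE scale1r.
by move=> a; rewrite (tr_1B (ca_tr hB)) scale1r.
Qed.

(** [nu_mulb] at x / b_g is solved for the unknown coaction: right multiplication by b_g (x) g is
    undone by b_g^-1 (x) g^-1. *)
Lemma nu_mulbV x g : nu (x / b g) = rmul (hG g^-1%g) (b g)^-1 (nu x).
Proof.
rewrite -{2}(divrK (b_unit g) x) nu_mulb rmul_rmul -hGM mulgV divrr //.
by rewrite hG1 rmul11.
Qed.

Lemma grouplike_mulb g h y : grouplike g y -> grouplike (g * h)%g (y * b h).
Proof. by move=> yE; rewrite /grouplike nu_mulb yE rmul_tens hGM. Qed.

Lemma grouplike_mulbV g h y : grouplike g y -> grouplike (g * h^-1)%g (y / b h).
Proof. by move=> yE; rewrite /grouplike nu_mulbV yE rmul_tens hGM. Qed.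

Lemma grouplike_mulbX g h m y :
  grouplike g y -> grouplike (g * h ^+ m)%g (y * b h ^+ m).
Proof.
elim: m => [|m IHm] yE; first by rewrite expg0 expr0 mulr1 mulg1.
by rewrite expgSr exprSr mulgA mulrA; apply/grouplike_mulb/IHm.
Qed.

Lemma grouplike_mulbVX g h m y :
  grouplike g y -> grouplike (g * (h^-1) ^+ m)%g (y * (b h)^-1 ^+ m).
Proof.
elim: m => [|m IHm] yE; first by rewrite expg0 expr0 mulr1 mulg1.
by rewrite expgSr exprSr mulgA mulrA; apply/grouplike_mulbV/IHm.
Qed.

(** * Coinvariant elements built from the [b g] and [bx] *)

Lemma grouplike1 : grouplike 1%g 1. Proof. exact: ca_1 hB. Qed.

Lemma bXorder_unit_in g : unit_in (coinv nu) (b g ^+ #[g]%g).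
Proof.
have h1 := grouplike_mulbX g #[g]%g grouplike1.
have h2 := grouplike_mulbVX g #[g]%g grouplike1.
rewrite expgVn expg_order invg1 mulg1 !mul1r in h1 h2.
split=> //; exists ((b g)^-1 ^+ #[g]%g) => //.
by rewrite exprVn divrr ?mulVr ?unitrX.
Qed.

(** The terms of the coaction that contain x cancel by x g = chi(g) g x, so the commutator is
    grouplike of degree gz. Dividing by b_g and b_z brings the degree to 1, z being central. *)
Lemma coinv_commutator g :
  coinv nu ((bx * b g - chi g *: (b g * bx)) / b g / b z).
Proof.
have gz : (g * z = z * g)%g by apply/esym/dz_central.
suff : grouplike (g * z)%g (bx * b g - chi g *: (b g * bx)).
  by move/(grouplike_mulbV g)/(grouplike_mulbV z); rewrite gz mulgK mulgV.
rewrite /grouplike linearB linearZ nu_mulb nu_mulbx nu_b nu_bx /=.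
rewrite linearD /= twist_tens expr0 scale1r !rmul_tens.
rewrite hXG tensZl linearB /= [tens _ (chi g *: _)]linearZ scalerDr -!hGM.
by rewrite mulr1 mul1r gz opprD addrACA subrr addr0.
Qed.

(** As for [Delta], the weight (qp)^(m-i) combines q^(m-i) from [twist] with chi(z)^(m-i) from
    moving x^(m-i) past z. The case m = n is included for the sake of b_x^n. *)
Lemma nu_mulbxX g y m : grouplike g y -> (m <= n)%N ->
  nu (y * bx ^+ m) = \sum_(i < m.+1) gauss (dqp D) m i *:
    tens (hG (g * z ^+ i)%g * hX D ^+ (m - i)) (y * bx ^+ i).
Proof.
move=> yE; elim: m => [_|m IHm ltmn].
  by rewrite big_ord1 gaussn0 scale1r !expr0 !mulr1 mulg1.
rewrite exprSr mulrA nu_mulbx IHm 1?ltnW // !linear_sum -big_split /=.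
rewrite (gauss_sumS _ m (fun i =>
  tens (hG (g * z ^+ i)%g * hX D ^+ (m.+1 - i)) (y * bx ^+ i))).
apply: eq_bigr => i _; have leim : (i <= m)%N by rewrite -ltnS.
rewrite 3!linearZ /= rmul_tens -hvecE ?(leq_ltn_trans (leq_subr i m)) //.
rewrite twist_tens linearZ /= rmul_tens hvecE ?(leq_ltn_trans (leq_subr i m)) //.
rewrite -!mulrA hXnG mulr1 -exprSr -exprSr -subSn // -scalerAr mulrA -hGM.
rewrite tensZl addrC -scalerDr [X in _ *: (_ + X)]scalerA -exprMn -mulgA -expgSr.
by rewrite subSS.
Qed.

(** In the coaction on b_x^n the middle Gaussian binomials vanish at the primitive root qp and the
    first term contains x^n = 0. Hence b_x^n has degree z^n. *)
Lemma coinv_bxn : hX D ^+ n = 0 ->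
  coinv nu (bx ^+ n * b z ^ (#[z]%g%:Z - n%:Z)).
Proof.
move=> Xn0; have bxnE : grouplike (z ^+ n)%g (bx ^+ n).
  have := nu_mulbxX grouplike1 (leqnn n); rewrite mul1r /grouplike => ->.
  rewrite big_ord_recr /= gaussnn scale1r subnn expr0 mulr1 !mul1r mul1g.
  rewrite big1 ?add0r // => i _; rewrite /=.
  have [->|i0] := eqVneq (i : nat) 0%N.
    by rewrite subn0 Xn0 mulr0 -(scale0r (0 : HD D)) tensZl scale0r scaler0.
  suff -> : gauss (dqp D) n i = 0 by rewrite scale0r.
  by apply: gauss_prim_root (qp_prim D) _; rewrite lt0n i0 /=.
(* The exponent |z| - n may be negative, so the factor is built from |z| copies of b_z and n of its
   inverse. *)
have := grouplike_mulbVX z n (grouplike_mulbX z #[z]%g bxnE).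
rewrite expg_order mulg1 expgVn mulgV -mulrA.
by rewrite exprzDr // -exprnP exprVn -exprnN.
Qed.

(** * Leading powers of x: generation and independence *)

Lemma nu_mulbxX_high g y m c : grouplike g y -> (m <= c.2)%N ->
  nu (y * bx ^+ m) c = tens (hvec g m) y c.
Proof.
move=> yE lemc; have ltmn := leq_ltn_trans lemc (ltn_ord c.2).
rewrite (nu_mulbxX yE) 1?ltnW // big_ord_recl /= gaussn0 scale1r expr0 mulr1.
rewrite subn0 expg0 mulg1 -hvecE // ffunE sum_ffunE big1 ?addr0 => [|i _].
  by rewrite ffunE.
rewrite -hvecE ?(leq_ltn_trans (leq_subr _ _)) // !ffunE /= /bump /= add1n.
rewrite andbC gtn_eqF ?scale0r ?scaler0 // (leq_trans _ lemc) //.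
by rewrite ltn_subrL (leq_ltn_trans _ (ltn_ord i)).
Qed.

(* Coassociativity: only 1 (x) x^m in Delta(x^m) has the top power of x on
   the right. *)
Lemma grouplike_top x m g (ltmn : (m < n)%N) :
  (forall c, (m < c.2)%N -> nu x c = 0) ->
  grouplike g (nu x (g, Ordinal ltmn)).
Proof.
move=> xm; apply/ffunP=> a.
have /ffunP/(_ (a, (g, Ordinal ltmn))) := nu_coassoc (ca_nu hB) x.
rewrite /coactl /tDelta /extV !ffunE /= => ->.
have DE c : DeltaF c (a, (g, Ordinal ltmn)) = \sum_(i < c.2.+1)
    gauss (dqp D) c.2 i * (hvec c.1 i a * hvec (c.1 * z ^+ i)%g (c.2 - i) (g, Ordinal ltmn)).
  have := iter_DeltaX c.1 (ltn_ord c.2); rewrite -/(DeltaF c) => ->.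
  by rewrite sum_ffunE; apply: eq_bigr => i _; rewrite !ffunE.
rewrite (bigD1 (g, Ordinal ltmn)) //= [X in _ + X]big1 ?addr0 => [|c cgm].
  rewrite DE big_ord_recl /= gaussn0 mul1r big1 ?addr0 => [|i _].
    by rewrite !ffunE /= expg0 mulg1 subn0 !eqxx mulr1.
  rewrite [hvec (_ * _)%g _ _]ffunE /= /bump /= add1n.
  rewrite andbC gtn_eqF ?mulr0 // ltn_subrL /=.
  exact: leq_ltn_trans (ltn_ord i).
(* Higher powers are excluded by [xm]; lower or equal ones reach x^m on the right only for i = 0 and
   the index (g, m) itself. *)
have [ltmc|] := ltnP m c.2; first by rewrite xm ?scaler0.
move=> lecm; rewrite DE big1 ?scale0r // => i _.
rewrite [hvec (_ * _)%g _ _]ffunE /= andbC.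
case: eqVneq => [mE|_]; last by rewrite /= !mulr0.
have i0 : i = 0%N :> nat by have := ltn_ord i; lia.
rewrite i0 expg0 mulg1 eq_sym; case: eqP => [c1|_]; last by rewrite !mulr0.
case/negP: cgm; rewrite -pair_eqE /= c1 eqxx -val_eqE /=.
by rewrite mE i0 subn0.
Qed.

Lemma span_of_top m x : (forall c, (m <= c.2)%N -> nu x c = 0) ->
  exists f : hidx D -> B, (forall a, coinv nu (f a)) /\
    x = \sum_a f a * (b a.1 * bx ^+ a.2).
Proof.
elim: m x => [|m IHm] x xm.
  (* Here [nu x] is zero, hence so is x by the counit axiom. *)
  exists (fun=> 0); split=> [a|]; first by rewrite /coinv !linear0.
  rewrite big1 => [|a _]; last exact: mul0r.
  rewrite -[LHS](nu_counit (ca_nu hB)) /teps big1 // => a _.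
  by rewrite xm // scaler0.
have [ltmn|lenm] := ltnP m n; last first.
  by apply: IHm => c /(leq_trans lenm); rewrite leqNgt ltn_ord.
pose y g := nu x (g, Ordinal ltmn).
have yE g : grouplike g (y g) by apply: grouplike_top => c; apply: xm.
have [c lemc|f [fC fE]] := IHm (x - \sum_g y g * bx ^+ m).
  rewrite linearB linear_sum /= !ffunE sum_ffunE.
  under eq_bigr => g _ do rewrite (nu_mulbxX_high (yE g)) // !ffunE.
  case: (ltngtP m c.2) lemc => // [ltmc _|mE _].
    rewrite xm // big1 ?subr0 // => g _.
    by rewrite andbF scale0r.
  rewrite (bigD1 c.1) //= eqxx scale1r big1 ?addr0 => [|g gc].
    rewrite /y; case: c mE => g j /= mE; have -> : Ordinal ltmn = j by apply/val_inj.
    by rewrite subrr.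
  by rewrite eq_sym (negPf gc) scale0r.
(* The subtracted term is rewritten as (y_g b_g^-1)(b_g b_x^m), whose left factor has degree 1. *)
exists (fun a => f a + if a.2 == m :> nat then y a.1 / b a.1 else 0); split=> [a|].
  have [_|_] := eqVneq; last by rewrite addr0.
  rewrite /coinv !linearD /= (fC a); congr (_ + _).
  by have := grouplike_mulbV a.1 (yE a.1); rewrite mulgV.
rewrite -(subrK (\sum_g y g * bx ^+ m) x) fE.
under [RHS]eq_bigr => a _ do rewrite mulrDl.
rewrite big_split; congr (_ + _); rewrite -(pair_bigA _ (fun g (i : 'I_n) =>
  (if i == m :> nat then y g / b g else 0) * (b g * bx ^+ i))) /=.
apply: eq_bigr => g _; rewrite (bigD1 (Ordinal ltmn)) //= eqxx.
rewrite mulrA divrK // big1 ?addr0 // => i; rewrite -val_eqE /= => /negPf->.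
exact: mul0r.
Qed.

Lemma b_bx_left_basis :
  left_basis (coinv nu) (fun gi : dG D * 'I_n => b gi.1 * bx ^+ gi.2).
Proof.
split=> [x|f fC f0]; first by apply: (@span_of_top n) => c; rewrite leqNgt ltn_ord.
have fbE a : grouplike a.1 (f a * b a.1).
  by rewrite -[a.1 in X in grouplike X]mul1g; apply: grouplike_mulb; apply: fC.
(* Descending induction on the power of x, with [d] bounding n - a.2. *)
suff fz d a : (n <= a.2 + d)%N -> f a = 0 by move=> a; apply: (fz n); rewrite leq_addl.
elim: d a => [a|d IHd a lea]; first by rewrite addn0 leqNgt ltn_ord.
have := congr1 (fun y => nu y a) f0; rewrite linear_sum linear0 sum_ffunE ffunE.
rewrite (bigD1 a) //= mulrA (nu_mulbxX_high (fbE a)) // ffunE hvec_idx eqxx scale1r.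
rewrite big1 ?addr0 => [fb0|c ca].
  by rewrite -(mulrK (b_unit a.1) (f a)) fb0 mul0r.
(* Terms with a higher power vanish by induction; the others contribute only their leading
   coefficient, at index c, which differs from a. *)
have [lec|ltc] := leqP c.2 a.2; last first.
  by rewrite IHd ?mul0r ?linear0 ?ffunE //; lia.
by rewrite mulrA (nu_mulbxX_high (fbE c)) // ffunE hvec_idx eq_sym (negPf ca) scale0r.
Qed.

End Coaction.

(** * From the associated objects to the values of [s] and [nu] *)

Lemma in_sum1 (k : fieldType) (B : unitAlgType k) (I : finType) (A : {set I})
    (P : I -> B -> Prop) i x :
  i \in A -> (forall j, j \in A -> P j 0) -> P i x -> in_sum A P x.
Proof.
move=> Ai P0 Px; exists (fun j => if j == i then x else 0); split=> [j Aj|].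
  by case: eqP => [->|_] //; apply: P0.
by rewrite (bigD1 i) //= eqxx big1 ?addr0 // => j /andP[_ /negPf->].
Qed.

Theorem theorem4p2 (k : fieldType) (D : datum k)
  (hpq : (dp D, dq D) <> (1, -1))
  (B : unitAlgType k)
  (s : {linear tH D B -> tH D B}) (nu : {linear B -> tH D B})
  (hB : comodule_algebra s nu)
  (Bgz : dG D -> {perm dG D} -> B -> Prop)
  (alpha : {lrmorphism B -> B}) (U : {linear B -> B})
  (hassoc : associated_objects s nu Bgz alpha U)
  (hcleft : cleft s nu)
  (bx : B) (b : dG D -> B)
  (b_unit : forall g, b g \is a GRing.unit)
  (b_1 : b 1%g = 1)
  (ha : forall g, Bgz g 1%g (b g) /\ U (b g) = 0)
  (hb : Bgz (dz D) 1%g bx /\ U bx = 1)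
  (hc : alpha bx = dq D *: bx)
  (hd : forall g, alpha (b g) = b g)
  (gamma : {linear HD D -> B})
  (gammaE : forall g i, (i < dn D)%N -> gamma (hG g * hX D ^+ i) = b g * bx ^+ i) :
  (* (1) *)
  left_basis (coinv nu) (fun gi : dG D * 'I_(dn D) => b gi.1 * bx ^+ gi.2)
  /\
  (* (2) *)
  ((forall g, unit_in (coinv nu) (b g ^+ #[g]%g)) /\
   (forall g, coinv nu
      ((bx * b g - chi g *: (b g * bx)) * (b g)^-1 * (b (dz D))^-1)) /\
   (hX D ^+ dn D = 0 ->
    coinv nu (bx ^+ dn D * b (dz D) ^ (#[dz D]%g%:Z - (dn D)%:Z))))
  /\
  (* (3) *)
  (forall g i zeta c, (i < dn D)%N -> zeta \in Autchiz D ->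
     Bgz 1%g zeta c -> U c = 0 ->
     weak_action s gamma (hG g * hX D ^+ i) c =
     \sum_(j < i.+1)
       ((-1) ^+ j * dqp D ^+ (j * (j - 1) %/ 2) * qbinom (dqp D) i j) *:
         (b g * bx ^+ (i - j) * iter j alpha c * bx ^+ j
          * (b (zeta g * dz D ^+ i)%g)^-1))
  /\
  (* (4) *)
  (forall g h m r, (m < dn D)%N -> (r < dn D)%N ->
     cocycle gamma (hG g * hX D ^+ m) (hG h * hX D ^+ r) =
     \sum_(i < m.+1) \sum_(j < r.+1 | (m + r - i - j < dn D)%N)
       (let xi := (m + r - i - j)%N in
        (-1) ^+ xi * qbinom (dqp D) m i * qbinom (dqp D) r j
        * dqp D ^+ (xi * (xi - 1) %/ 2 + m * j - i * j) * chi h ^+ (m - i)) *: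
         (b g * bx ^+ i * b h * bx ^+ (m + r - i)
          * (b (g * h * dz D ^+ (m + r))%g)^-1)
     + lam D *:
       \sum_(i < m.+1) \sum_(j < r.+1 | (dn D <= m + r - i - j)%N)
       (let xi' := (m + r - i - j - dn D)%N in
        (-1) ^+ xi' * qbinom (dqp D) m i * qbinom (dqp D) r j
        * dqp D ^+ (xi' * (xi' - 1) %/ 2 + m * j - i * j) * chi h ^+ (m - i)) *:
         (b g * bx ^+ i * b h * bx ^+ (m + r - i - dn D)
          * (b (g * h * dz D ^+ (m + r))%g)^-1)
     - lam D *:
       \sum_(i < m.+1) \sum_(j < r.+1 | (dn D <= m + r - i - j)%N)
       (let xi' := (m + r - i - j - dn D)%N in
        (-1) ^+ xi' * qbinom (dqp D) m i * qbinom (dqp D) r j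
        * dqp D ^+ (xi' * (xi' - 1) %/ 2 + m * j - i * j) * chi h ^+ (m - i)) *:
         (b g * bx ^+ i * b h * bx ^+ (m + r - i - dn D)
          * (b (g * h * dz D ^+ (m + r - dn D))%g)^-1)).
Proof.
have id_in : 1%g \in Autchiz D.
  rewrite inE group1 perm1 eqxx; apply/forallP=> g.
  by rewrite perm1.
have B0 g zeta : zeta \in Autchiz D -> Bgz g zeta 0.
  by move=> /(ao_subspace hassoc g)[].
have hs zeta g x : zeta \in Autchiz D -> Bgz g zeta x -> forall h i, (i < dn D)%N ->
    s (tens (hG h * hX D ^+ i) x) = tens (hG (zeta h) * hX D ^+ i) (iter i alpha x).
  move=> Azeta Bx; apply: (ao_s hassoc Azeta).
  by apply: (in_sum1 (i := g)) => // l _; apply: B0.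
have hnu g x : Bgz g 1%g x ->
    nu x = \sum_(i < dn D) (qfact (dqp D) i)^-1 *:
      tens (hG ((dz D) ^- i * g)%g * hX D ^+ i) (iter i U x).
  by move=> Bx; apply/(ao_nu hassoc)/(in_sum1 (i := 1%g)) => // zeta; apply: B0.
have s_b a g : s (tens (hbas a) (b g)) = tens (hbas a) (b g).
  rewrite /hbas hvecE // (hs _ _ _ id_in (ha g).1) // perm1.
  by congr tens; elim: (a.2 : nat) => //= i ->; apply: hd.
have s_bx a : s (tens (hbas a) bx) = dq D ^+ a.2 *: tens (hbas a) bx.
  rewrite /hbas hvecE // (hs _ _ _ id_in hb.1) // perm1 -linearZ /=.
  congr tens; elim: (a.2 : nat) => [|i IHi] /=; first by rewrite scale1r.
  by rewrite IHi linearZ /= hc scalerA -exprSr.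
have U0 i : iter i U 0 = 0 by elim: i => //= i ->; rewrite linear0.
have qf0 : qfact (dqp D) 0 = 1 by rewrite /qfact qfact_poly0 hornerC.
have qf1 : qfact (dqp D) 1 = 1.
  by rewrite /qfact qfact_polyS qfact_poly0 mul1r /qnum_poly big_ord1 hornerXn.
have nu_b g : grouplike nu g (b g).
  rewrite /grouplike (hnu g _ (ha g).1) (bigD1 (Ordinal (dn_gt0 D))) //=.
  rewrite qf0 invr1 scale1r expg0 invg1 mul1g expr0 mulr1 big1 ?addr0 // => -[[|i] lti] //= _.
  by rewrite -iterS iterSr (ha g).2 U0 linear0 scaler0.
have nu_bx : nu bx = tens (hG (dz D)) bx + tens (hX D) 1.
  rewrite (hnu _ _ hb.1) (bigD1 (Ordinal (dn_gt0 D))) //=.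
  rewrite (bigD1 (Ordinal (dn_gt1 D))) //= big1 ?addr0.
    rewrite qf0 qf1 invr1 !scale1r expg0 invg1 mul1g expr0 mulr1 hb.2 expg1 mulVg.
    by rewrite hG1 mul1r.
  move=> -[[|[|i]] lti] //= _.
  (* U^2(b_x) = U(1), and U(1) = 0 because 1 is b_1, an element of the kernel of U. *)
  rewrite -!iterS 2!iterSr hb.2 -b_1 (ha _).2.
  by rewrite U0 linear0 scaler0.
split; first exact (b_bx_left_basis hB b_unit s_b s_bx nu_b nu_bx).
split; first split; first exact (bXorder_unit_in hB b_unit s_b nu_b).
  split; first exact (coinv_commutator hB b_unit s_b s_bx nu_b nu_bx).
  exact (coinv_bxn hB b_unit s_b s_bx nu_b nu_bx).
split=> [g i zeta c ltin Azeta Bc _|]; last exact: (cocycle_formula b_unit gammaE).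
apply: (weak_action_formula b_unit gammaE) => // [|j]; first exact: hs Azeta Bc.
move: Azeta; rewrite inE => /andP[Azeta /andP[/eqP zz _]].
have zetaM h l : zeta (h * l)%g = (zeta h * zeta l)%g.
  by have /morphicP := Aut_morphic Azeta; apply; rewrite inE.
rewrite zetaM; congr (_ * _)%g; elim: j => [|j IHj].
  by rewrite expg0; apply: (mulgI (zeta 1%g)); rewrite -zetaM !mulg1.
by rewrite !expgS zetaM zz IHj.
Qed.
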